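(* Let $(M,H)$ be a Hamilton space with Hamiltonian vector field $\rho_H$ and adapted tangent structure $\mathcal{J}_H$. Let $\mathcal{N}$ be an arbitrary nonlinear connection on $T^{*}M\setminus\{0\}$ with local coefficients $\mathcal{N}_{ij}$, and let $\nabla$ be the dynamical covariant derivative induced by $\rho_H$ and $\mathcal{N}$. The following conditions are equivalent: (i) $\nabla$ restricts to a map $\nabla:\mathfrak{X}_{\rho_H}\to\mathfrak{X}_{\rho_H}$ and satisfies the Leibniz rule with respect to the $*$ product, i.e. $\nabla(f*X)=(\nabla f)*X+f*(\nabla X)$ for all $f\in C^\infty(T^{*}M\setminus\{0\})$ and $X\in\mathfrak{X}_{\rho_H}$; (ii) $\nabla\mathcal{J}_H=0$; (iii) $\mathcal{L}_{\rho_H}\mathcal{J}_H+\mathcal{N}=0$; (iv) in every induced local chart, $$\mathcal{N}_{ij}=\frac12\left(\{g_{ij},H\}-\left(g_{ik}\frac{\partial^2H}{\partial p_k\partial x^j}+g_{jk}\frac{\partial^2H}{\partial p_k\partial x^i}\right)\right).$$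
   Context: Hamilton space: $M$ is a smooth $n$-dimensional manifold and $H:T^{*}M\to\mathbb{R}$ is smooth on $T^{*}M\setminus\{0\}$ (zero section removed), continuous on the zero section, with $g^{ij}=\frac{\partial^2H}{\partial p_i\partial p_j}$ of rank $n$ and constant signature on $T^{*}M\setminus\{0\}$, in induced coordinates $(x^i,p_i)$; $(g_{ij})$ is the inverse matrix. All structures are considered on $T^{*}M\setminus\{0\}$. Adapted tangent structure: $\mathcal{J}_H=g_{ij}\,dx^i\otimes\frac{\partial}{\partial p_j}$, i.e. $\mathcal{J}_H(\partial/\partial x^i)=g_{ij}\,\partial/\partial p_j$, $\mathcal{J}_H(\partial/\partial p_i)=0$. Hamiltonian vector field: $\rho_H=\frac{\partial H}{\partial p_i}\frac{\partial}{\partial x^i}-\frac{\partial H}{\partial x^i}\frac{\partial}{\partial p_i}$, the vector field with $i_{\rho_H}\omega=-dH$, where $\omega=dp_i\wedge dx^i$. Poisson bracket: $\{g_{ij},H\}=\frac{\partial g_{ij}}{\partial p_k}\frac{\partial H}{\partial x^k}-\frac{\partial H}{\partial p_k}\frac{\partial g_{ij}}{\partial x^k}$. Nonlinear connection: a $(1,1)$-tensor field $\mathcal{N}$ with $\mathcal{N}^2=\mathrm{Id}$ and $\ker(\mathrm{Id}+\mathcal{N})$ equal to the vertical distribution spanned by $\partial/\partial p_i$; $h=\frac12(\mathrm{Id}+\mathcal{N})$, $v=\frac12(\mathrm{Id}-\mathcal{N})$. Its local coefficients $\mathcal{N}_{ij}$ are defined by the adapted basis $\frac{\delta}{\delta x^i}=h\left(\frac{\partial}{\partial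 x^i}\right)=\frac{\partial}{\partial x^i}+\mathcal{N}_{ij}\frac{\partial}{\partial p_j}$ of the horizontal distribution $\ker(\mathrm{Id}-\mathcal{N})$. Dynamical covariant derivative: $\nabla f=\rho_H(f)$ on functions, $\nabla X=h[\rho_H,hX]+v[\rho_H,vX]$ on vector fields, and $(\nabla T)(X)=\nabla(TX)-T(\nabla X)$ for a $(1,1)$-tensor field $T$. Also $(\mathcal{L}_{\rho_H}T)(X)=[\rho_H,TX]-T[\rho_H,X]$. The set of Newtonoid vector fields is $\mathfrak{X}_{\rho_H}=\{X\in\mathcal{X}(T^{*}M\setminus\{0\}):\mathcal{J}_H[\rho_H,X]=0\}$. The $*$ product of a function $f$ and a vector field $X$ is $f*X=fX+\mathcal{J}_H[\rho_H,fX]=fX+f\mathcal{J}_H[\rho_H,X]+\rho_H(f)\mathcal{J}_HX$; for $X\in\mathfrak{X}_{\rho_H}$ it equals $fX+\rho_H(f)\mathcal{J}_HX$. *)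

(* Defs.v *)
From HB Require Import structures.
From mathcomp Require Export all_boot all_order all_algebra.
From mathcomp Require Export all_classical all_reals all_analysis.
Export Order.TTheory GRing.Theory Num.Theory.
Export numFieldNormedType.Exports.

Set Implicit Arguments.
Unset Strict Implicit.
Unset Printing Implicit Defensive.

Local Open Scope classical_set_scope.
Local Open Scope ring_scope.

Definition partial (R : realType) (m : nat) (i : 'I_m) (f : 'rV[R]_m -> R)
    : 'rV[R]_m -> R :=
  fun y => 'D_(delta_mx 0 i) f y.

(* C^oo on a neighbourhood of y: all iterated partial derivatives are
   (Frechet) differentiable at every point close to y. *)
Definition smooth_near (R : realType) (m : nat) (y : 'rV[R]_m)
    (f : 'rV[R]_m -> R) : Prop :=
  \forall y' \near y,
    forall s : seq 'I_m, differentiable (foldr (@partial R m) f s) y'.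

(* [coord c] is only meaningful on [dom c]. *)
Record chart (R : realType) (T : Type) (m : nat) : Type := Chart {
  dom : set T;
  coord : T -> 'rV[R]_m }.

Definition coordf (R : realType) (T : Type) (m : nat) (c : chart R T m)
    (i : 'I_m) : T -> R :=
  fun x => coord c x 0 i.

(* f \o (coord c)^-1 on [coord c @` dom c], extended by 0. *)
Definition local_rep (R : realType) (T : Type) (m : nat) (c : chart R T m)
    (f : T -> R) : 'rV[R]_m -> R :=
  fun y => xget 0 (f @` [set x | dom c x /\ coord c x = y]).

Definition smooth_at (R : realType) (T : Type) (m : nat)
    (A : set (chart R T m)) (x : T) (f : T -> R) : Prop :=
  forall c, A c -> dom c x -> smooth_near (coord c x) (local_rep c f).

Definition smooth (R : realType) (T : Type) (m : nat)
    (A : set (chart R T m)) (f : T -> R) : Prop :=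
  forall x, smooth_at A x f.

Definition functional (R : realType) (T : Type) : Type := (T -> R) -> R.

(* The tangent vector d/dx^i at x in the chart c, as a derivation of the
   functions that are smooth near x.  Derivations are given the value 0 on the
   other functions, so that two tangent vectors are equal as soon as they agree
   on functions that are smooth near x. *)
Definition coord_vec (R : realType) (T : Type) (m : nat)
    (A : set (chart R T m)) (c : chart R T m) (i : 'I_m) (x : T)
    : functional R T :=
  fun f => if `[< smooth_at A x f >]
           then partial i (local_rep c f) (coord c x) else 0.

Definition tangent (R : realType) (T : Type) (m : nat)
    (A : set (chart R T m)) (x : T) (v : functional R T) : Prop :=
  exists c (a : 'I_m -> R),
    [/\ A c, dom c x & v = \sum_(i < m) a i *: coord_vec A c i x].

Definition vector_field (R : realType) (T : Type) (m : nat)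
    (A : set (chart R T m)) (X : T -> functional R T) : Prop :=
  (forall x, tangent A x (X x)) /\
  (forall c x i, A c -> dom c x ->
     smooth_at A x (fun y => X y (coordf c i))).

Definition vf_app (R : realType) (T : Type) (X : T -> functional R T)
    (f : T -> R) : T -> R :=
  fun x => X x f.

Definition fmul (R : realType) (T : Type) (f : T -> R)
    (X : T -> functional R T) : T -> functional R T :=
  fun x => f x *: X x.

Definition bracket (R : realType) (T : Type) (m : nat)
    (A : set (chart R T m)) (X Y : T -> functional R T)
    : T -> functional R T :=
  fun x f => if `[< smooth_at A x f >]
             then X x (vf_app Y f) - Y x (vf_app X f) else 0.

(* (1,1)-tensor fields as smooth families of endomorphisms of the tangent
   spaces; the values on functionals that are not tangent are irrelevant. *)
Definition tensor11 (R : realType) (T : Type) (m : nat)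
    (A : set (chart R T m)) (K : T -> functional R T -> functional R T)
    : Prop :=
  [/\ forall x v, tangent A x v -> tangent A x (K x v),
      forall x (a : R) v w, tangent A x v -> tangent A x w ->
        K x (a *: v + w) = a *: K x v + K x w
    & forall c x i j, A c -> dom c x ->
        smooth_at A x (fun y => K y (coord_vec A c i y) (coordf c j))].

Definition tapp (R : realType) (T : Type)
    (K : T -> functional R T -> functional R T) (X : T -> functional R T)
    : T -> functional R T :=
  fun x => K x (X x).

Definition compatible (R : realType) (T : Type) (m : nat)
    (c c' : chart R T m) : Prop :=
  forall x i, dom c x -> dom c' x ->
    smooth_near (coord c x) (local_rep c (coordf c' i)).

Definition topological_chart (R : realType) (M : topologicalType) (n : nat)
    (c : chart R M n) : Prop :=
  [/\ open (dom c),
      {in dom c &, injective (coord c)},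
      {in dom c, continuous (coord c)}
    & forall O, open O -> O `<=` dom c -> open (coord c @` O)].

Record smooth_manifold (R : realType) (M : topologicalType) (n : nat)
    (A : set (chart R M n)) : Prop := SmoothManifold {
  mfd_hausdorff : hausdorff_space M;
  mfd_second_countable : @second_countable M;
  mfd_chart : forall c, A c -> topological_chart c;
  mfd_cover : forall x, exists2 c, A c & dom c x;
  mfd_compatible : forall c c', A c -> A c' -> compatible c c';
  mfd_maximal : forall c, topological_chart c ->
    (forall c', A c' -> compatible c c' /\ compatible c' c) -> A c }.

(* Linear forms on the tangent space at x, extended by 0 outside of it. *)
Definition covector (R : realType) (M : Type) (n : nat)
    (A : set (chart R M n)) (x : M) (p : functional R M -> R) : Prop :=
  (forall (a : R) v w, tangent A x v -> tangent A x w ->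
     p (a *: v + w) = a * p v + p w) /\
  (forall v, ~ tangent A x v -> p v = 0).

Record cotangent (R : realType) (M : Type) (n : nat)
    (A : set (chart R M n)) : Type := Cotangent {
  base : M;
  mom : functional R M -> R;
  _ : covector A base mom }.

(* The induced coordinates (x^i, p_i), with p_i = p (d/dx^i). *)
Definition cot_chart (R : realType) (M : Type) (n : nat)
    (A : set (chart R M n)) (c : chart R M n)
    : chart R (cotangent A) (n + n) :=
  Chart [set z | dom c (base z)]
        (fun z => row_mx (coord c (base z))
                         (\row_i mom z (coord_vec A c i (base z)))).
Arguments cot_chart {R M n} A c.

(* The cotangent bundle with the zero section removed. *)
Definition slit (R : realType) (M : Type) (n : nat)
    (A : set (chart R M n)) : Type :=
  {z : cotangent A | mom z <> 0}.
Arguments slit {R M n} A.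

Definition slit_chart (R : realType) (M : Type) (n : nat)
    (A : set (chart R M n)) (c : chart R M n) : chart R (slit A) (n + n) :=
  Chart [set z | dom (cot_chart A c) (sval z)]
        (fun z => coord (cot_chart A c) (sval z)).
Arguments slit_chart {R M n} A c.

Definition slit_atlas (R : realType) (M : Type) (n : nat)
    (A : set (chart R M n)) : set (chart R (slit A) (n + n)) :=
  [set slit_chart A c | c in A].
Arguments slit_atlas {R M n} A.

Definition on_slit (R : realType) (M : Type) (n : nat)
    (A : set (chart R M n)) (H : cotangent A -> R) : slit A -> R :=
  fun z => H (sval z).

(* d/dx^i and d/dp_i in the coordinates induced by c. *)
Definition ddx (R : realType) (M : Type) (n : nat) (A : set (chart R M n))
    (c : chart R M n) (i : 'I_n) (z : slit A) : functional R (slit A) :=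
  coord_vec (slit_atlas A) (slit_chart A c) (lshift n i) z.

Definition ddp (R : realType) (M : Type) (n : nat) (A : set (chart R M n))
    (c : chart R M n) (i : 'I_n) (z : slit A) : functional R (slit A) :=
  coord_vec (slit_atlas A) (slit_chart A c) (rshift n i) z.

Definition vertical (R : realType) (M : Type) (n : nat)
    (A : set (chart R M n)) (z : slit A) (v : functional R (slit A)) : Prop :=
  exists c (b : 'I_n -> R),
    [/\ A c, dom c (base (sval z)) & v = \sum_(i < n) b i *: ddp c i z].

(* g^{ij} *)
Definition hess (R : realType) (M : Type) (n : nat) (A : set (chart R M n))
    (H : cotangent A -> R) (c : chart R M n) (z : slit A) : 'M[R]_n :=
  \matrix_(i, j) ddp c i z (vf_app (ddp c j) (on_slit H)).

(* g_{ij} *)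
Definition gcov (R : realType) (M : Type) (n : nat) (A : set (chart R M n))
    (H : cotangent A -> R) (c : chart R M n) (i j : 'I_n) (z : slit A) : R :=
  invmx (hess H c z) i j.

(* Signature (q, n - q): G is congruent to diag(1, .., 1, -1, .., -1) with q
   entries equal to 1. *)
Definition has_signature (R : realType) (n : nat) (G : 'M[R]_n) (q : nat)
    : Prop :=
  exists2 P : 'M[R]_n, P \in unitmx
    & P *m G *m P^T = diag_mx (\row_(i < n) (if (i < q)%N then 1 else -1)).

Record hamilton_space (R : realType) (M : topologicalType) (n : nat)
    (A : set (chart R M n)) (H : cotangent A -> R) : Prop := HamiltonSpace {
  ham_manifold : smooth_manifold A;
  ham_smooth : smooth (slit_atlas A) (on_slit H);
  ham_continuous : forall c (z : cotangent A),
    A c -> dom c (base z) -> mom z = 0 ->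
    {for coord (cot_chart A c) z, continuous (local_rep (cot_chart A c) H)};
  ham_rank : forall c (z : slit A), A c -> dom c (base (sval z)) ->
    \rank (hess H c z) = n;
  ham_signature : exists2 q : nat, (q <= n)%N
    & forall c (z : slit A), A c -> dom c (base (sval z)) ->
        has_signature (hess H c z) q }.

(* The coordinate form, in every induced chart, of i_rho omega = - dH with
   omega = dp_i /\ dx^i. *)
Definition hamiltonian_vf (R : realType) (M : Type) (n : nat)
    (A : set (chart R M n)) (H : cotangent A -> R)
    (rho : slit A -> functional R (slit A)) : Prop :=
  forall c (z : slit A), A c -> dom c (base (sval z)) ->
    rho z = \sum_(i < n) (ddp c i z (on_slit H) *: ddx c i z
                          - ddx c i z (on_slit H) *: ddp c i z).

(* J = g_{ij} dx^i (x) d/dp_j in every induced chart; dx^i (v) is v applied to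
   the coordinate function x^i. *)
Definition adapted_tangent_structure (R : realType) (M : Type) (n : nat)
    (A : set (chart R M n)) (H : cotangent A -> R)
    (J : slit A -> functional R (slit A) -> functional R (slit A)) : Prop :=
  forall c (z : slit A) v, A c -> dom c (base (sval z)) ->
    tangent (slit_atlas A) z v ->
    J z v = \sum_(i < n) \sum_(j < n)
      (gcov H c i j z * v (coordf (slit_chart A c) (lshift n i)))
        *: ddp c j z.

Definition poisson (R : realType) (M : Type) (n : nat)
    (A : set (chart R M n)) (c : chart R M n) (f h : slit A -> R)
    (z : slit A) : R :=
  \sum_(k < n) (ddp c k z f * ddx c k z h - ddp c k z h * ddx c k z f).

Definition nonlinear_connection (R : realType) (M : Type) (n : nat)
    (A : set (chart R M n))
    (N : slit A -> functional R (slit A) -> functional R (slit A)) : Prop :=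
  [/\ tensor11 (slit_atlas A) N,
      forall z v, tangent (slit_atlas A) z v -> N z (N z v) = v
    & forall z v, tangent (slit_atlas A) z v ->
        (v + N z v = 0 <-> vertical z v)].

(* ker (Id + N) is the vertical distribution, so that (Id + N) / 2 is the
   horizontal projector. *)
Definition hproj (R : realType) (T : Type)
    (N : T -> functional R T -> functional R T)
    : T -> functional R T -> functional R T :=
  fun z v => 2^-1 *: (v + N z v).

Definition vproj (R : realType) (T : Type)
    (N : T -> functional R T -> functional R T)
    : T -> functional R T -> functional R T :=
  fun z v => 2^-1 *: (v - N z v).

Definition connection_coefficients (R : realType) (M : Type) (n : nat)
    (A : set (chart R M n))
    (N : slit A -> functional R (slit A) -> functional R (slit A))
    (Nc : chart R M n -> slit A -> 'M[R]_n) : Prop :=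
  forall c (z : slit A) i, A c -> dom c (base (sval z)) ->
    hproj N z (ddx c i z) = ddx c i z + \sum_(j < n) Nc c z i j *: ddp c j z.

Definition nabla_fun (R : realType) (T : Type) (rho : T -> functional R T)
    (f : T -> R) : T -> R :=
  vf_app rho f.

Definition nabla (R : realType) (T : Type) (m : nat) (A : set (chart R T m))
    (rho : T -> functional R T) (N : T -> functional R T -> functional R T)
    (X : T -> functional R T) : T -> functional R T :=
  tapp (hproj N) (bracket A rho (tapp (hproj N) X)) +
  tapp (vproj N) (bracket A rho (tapp (vproj N) X)).

Definition nabla_tensor (R : realType) (T : Type) (m : nat)
    (A : set (chart R T m)) (rho : T -> functional R T)
    (N K : T -> functional R T -> functional R T)
    (X : T -> functional R T) : T -> functional R T :=
  nabla A rho N (tapp K X) - tapp K (nabla A rho N X).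

Definition lie_tensor (R : realType) (T : Type) (m : nat)
    (A : set (chart R T m)) (rho : T -> functional R T)
    (K : T -> functional R T -> functional R T)
    (X : T -> functional R T) : T -> functional R T :=
  bracket A rho (tapp K X) - tapp K (bracket A rho X).

Definition newtonoid (R : realType) (T : Type) (m : nat)
    (A : set (chart R T m)) (rho : T -> functional R T)
    (J : T -> functional R T -> functional R T)
    (X : T -> functional R T) : Prop :=
  vector_field A X /\ tapp J (bracket A rho X) = 0.

Definition star (R : realType) (T : Type) (m : nat) (A : set (chart R T m))
    (rho : T -> functional R T) (J : T -> functional R T -> functional R T)
    (f : T -> R) (X : T -> functional R T) : T -> functional R T :=
  fmul f X + tapp J (bracket A rho (fmul f X)).

(* Main.v *)
Require Import Defs.
From mathcomp Require Import ring lra.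

Set Implicit Arguments.
Unset Strict Implicit.
Unset Printing Implicit Defensive.

Local Open Scope classical_set_scope.
Local Open Scope ring_scope.

(** Write h and v for the horizontal and vertical projectors, so that N = h - v.

The whole equivalence rests on one property of the Hamiltonian field: if V is a
vertical field, then J [rho, V] = - V ([J_bracket_vertical]).  Indeed the base
components of [rho, V] are - V_k d^2H/dp_k dp_i, and J contracts them with
g_ij, the inverse of that Hessian.  Applied to the vertical fields v X and J X,
it gives J [rho, X] = J (nabla X) - v X and h [rho, J X] = - h X, and then

  nabla J = L_rho J + N

as tensors ([nabla_tensor_lie]): conditions (ii) and (iii) say that one and the
same tensor vanishes.  In an induced chart this tensor kills d/dp_i and sends
d/dx^i to 2 (N_ij - K_ij) d/dp_j, where K_ij is the right-hand side of (iv)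
([lie_tensor_p]).  So (iv) implies (iii); for the converse d/dx^i, multiplied by
a bump function of the base, extends to a global field ([global_field]).

For (i), a field X is Newtonoid exactly when v X = J (nabla X).  If nabla J = 0,
applying nabla to this equation shows that nabla X is Newtonoid again
([newtonoid_nab]).  Expanding the star products, the Leibniz rule for f and X
fails by rho(f) (nabla J)(X) ([star_leibniz_defect]), so it holds when
nabla J = 0.  Conversely, nabla J takes the same value on a field Y and on the
Newtonoid field Y + J [rho, Y], so (i) makes rho(f) (nabla J)(Y) vanish for all f
and Y.  Where dH/dp <> 0, a coordinate of the base times a bump function has
rho(f) <> 0.  The other points are not interior to {dH/dp = 0}, because the
derivative of dH/dp along the fibres is the Hessian, which is invertible; there
nabla J vanishes by continuity ([rho_multiples_eq0]).

The first parts provide the calculus that this uses.  Smooth functions of the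
coordinates are closed under arithmetic operations and composition, and their
partial derivatives commute.  Hence on a set with compatible charts tangent
vectors can be expanded in any chart, and brackets of vector fields are vector
fields.  The induced charts of the slit cotangent bundle are such charts
([slit_good_atlas]). *)

Lemma sum_delta (R : comNzRingType) n (k : 'I_n) (F : 'I_n -> R) :
  \sum_i (k == i)%:R * F i = F k.
Proof.
rewrite (bigD1 k)//= eqxx mul1r big1 ?addr0// => i /negPf ik.
by rewrite eq_sym ik mul0r.
Qed.

Lemma sum_delta_r (R : comNzRingType) n (k : 'I_n) (F : 'I_n -> R) :
  \sum_i F i * (i == k)%:R = F k.
Proof.
by rewrite -[RHS]sum_delta; apply: eq_bigr => i _; rewrite mulrC eq_sym.
Qed.

(** * Partial derivatives *)

Section EuclideanCalculus.
Variable R : realType.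

Lemma near_eq_differentiable (V W : normedModType R) (f g : V -> W) (a : V) :
  (\near a, f a = g a) -> differentiable f a -> differentiable g a.
Proof.
move=> fg df; rewrite [g](_ : _ = f + (g - f)); last first.
  by rewrite addrC subrK.
apply: differentiableD => //; set h := g - f.
have h0 : \near a, h a = 0.
  by near=> y; rewrite /h -[LHS]/(g y - f y) -(near fg y) ?subrr//; near: y.
have ho : h \o shift a = cst (h a) + \0 +o_ 0 id.
  apply/eqaddoP => e e0.
  have : \forall y \near (0 : V), h (y + a) = 0.
    have := h0; rewrite (near_shift 0) /=.
    by apply: filterS => y; rewrite /= subr0.
  apply: filterS => y hy.
  rewrite -[(_ - _) y]/(h (y + a) - (h a + 0)) hy (nbhs_singleton h0).
  by rewrite addr0 subr0 normr0 mulr_ge0// ltW.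
pose z : {linear V -> W} := \0.
have dh : 'd h a = \0 :> (V -> W).
  apply: (@diff_unique _ _ _ h z) => //.
  by move=> x; exact: cvg_cst.
apply/diff_locallyP; rewrite dh; split => //.
by move=> x; exact: cvg_cst.
Unshelve. all: by end_near. Qed.

Section Smooth.
Variable m : nat.
Implicit Types (U : set 'rV[R]_m) (f g : 'rV[R]_m -> R) (y : 'rV[R]_m).

Lemma near_eq_partial i f g y :
  (\near y, f y = g y) -> partial i f y = partial i g y.
Proof. exact: near_eq_derive. Qed.

Lemma partialD i f g y : differentiable f y -> differentiable g y ->
  partial i (f \+ g) y = partial i f y + partial i g y.
Proof. by move=> df dg; rewrite /partial deriveD//; exact: diff_derivable. Qed.

Lemma partialM i f g y : differentiable f y -> differentiable g y ->
  partial i (f \* g) y = f y * partial i g y + g y * partial i f y.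
Proof. by move=> df dg; rewrite /partial deriveM//; exact: diff_derivable. Qed.

Lemma partialV i f y : differentiable f y -> f y != 0 ->
  partial i (fun y => (f y)^-1) y = - ((f y)^-1 * (f y)^-1) * partial i f y.
Proof.
move=> df f0; rewrite /partial deriveV//; last exact: diff_derivable.
by rewrite expr2 invfM.
Qed.

Lemma partial_cst i (a : R) y : partial i (cst a) y = 0.
Proof. exact: derive_cst. Qed.

Lemma partial_coord i j y : partial i (fun y => y 0 j) y = (i == j)%:R.
Proof.
rewrite /partial.
pose f : 'rV[R]_m -> R := fun y => y 0 j.
have df : differentiable f y by exact: differentiable_coord.
rewrite (@deriveE _ _ _ f)//.
have @g : {linear 'rV[R]_m -> R}.
  by exists f; do 2![eexists]; do ?[constructor];
     rewrite /f ?mxE// => ? *; rewrite ?mxE//; move=> ?; rewrite !mxE.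
rewrite -[f]/(g : _ -> _) diff_lin; last exact: coord_continuous.
by rewrite /= /f mxE eqxx /= eq_sym.
Qed.

End Smooth.

Lemma row_sum_delta m k (g : 'I_k -> 'rV[R]_m -> R) :
  (fun y => \row_j g j y) =
  \sum_(j < k) (fun y => g j y *: (delta_mx 0 j : 'rV[R]_k)).
Proof.
apply/funext => y; rewrite fct_sumE; apply/rowP => j.
rewrite mxE summxE (bigD1 j)//= !mxE !eqxx mulr1 big1 ?addr0// => i /negPf ij.
by rewrite !mxE eqxx /= eq_sym ij mulr0.
Qed.

Lemma differentiable_row m k (g : 'I_k -> 'rV[R]_m -> R) y :
  (forall j, differentiable (g j) y) ->
  differentiable (fun y => \row_j g j y : 'rV[R]_k) y.
Proof.
move=> dg; rewrite row_sum_delta; apply: differentiable_sum => j.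
exact: differentiableZl.
Qed.

Lemma derive_row m k (g : 'I_k -> 'rV[R]_m -> R) y v :
  (forall j, differentiable (g j) y) ->
  'D_v (fun y => \row_j g j y : 'rV[R]_k) y =
  \sum_(j < k) 'D_v (g j) y *: (delta_mx 0 j : 'rV[R]_k).
Proof.
move=> dg; rewrite row_sum_delta derive_sum; last first.
  by move=> j; apply/diff_derivable/differentiableZl.
apply: eq_bigr => j _; rewrite !deriveE//; last exact: differentiableZl.
by rewrite diffZl.
Qed.

(** The inner map is given by its components, which is the form in which
changes of charts occur. *)
Lemma partial_comp m k (f : 'rV[R]_k -> R) (g : 'I_k -> 'rV[R]_m -> R) i y :
  (forall j, differentiable (g j) y) ->
  differentiable f (\row_j g j y) ->
  partial i (fun y => f (\row_j g j y)) y =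
  \sum_(j < k) partial j f (\row_j g j y) * partial i (g j) y.
Proof.
move=> dg df; pose G y : 'rV[R]_k := \row_j g j y.
have dG : differentiable G y by exact: differentiable_row.
rewrite /partial (deriveE _ (differentiable_comp dG df)) diff_comp// /=.
rewrite -(deriveE _ dG) derive_row// linear_sum; apply: eq_bigr => j _.
by rewrite linearZ/= (deriveE _ df); exact: mulrC.
Qed.

(** * Smooth functions on an open set of coordinates *)

(** Smoothness near a point asks for one neighbourhood on which all the iterated
partial derivatives are differentiable.  Fixing an open set allows inductions
over the iterated derivatives that do not shrink the neighbourhood. *)
Definition smooth_on m (U : set 'rV[R]_m) (f : 'rV[R]_m -> R) : Prop :=
  forall y, U y -> forall s, differentiable (foldr (@partial R m) f s) y.

Lemma near_openP (T : topologicalType) (y : T) (P : T -> Prop) :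
  (\near y, P y) <-> exists2 U : set T, open U /\ U y & forall z, U z -> P z.
Proof.
have -> : (\near y, P y) = nbhs y P by [].
rewrite nbhsE; split=> [[U [oU Uy] UP]|[U [oU Uy] UP]]; exists U => //.
Qed.

Lemma smooth_nearP m (y : 'rV[R]_m) f :
  smooth_near y f <-> exists2 U, open U /\ U y & smooth_on U f.
Proof.
split=> [|[U [oU Uy] sf]].
  by move=> /near_openP[U oU sf]; exists U.
by near=> y' => s; apply: sf; near: y'; exact: open_nbhs_nbhs.
Unshelve. all: by end_near. Qed.

Lemma open_eq_near (T : topologicalType) (V : Type) (U : set T) (f g : T -> V) y :
  open U -> {in U, f =1 g} -> U y -> \near y, f y = g y.
Proof.
move=> oU fg Uy; near=> z; apply: fg; rewrite inE; near: z.
exact: open_nbhs_nbhs.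
Unshelve. all: by end_near. Qed.

(** Membership in [P] propagates to the iterated partial derivatives, and it
gives their differentiability.  The partial derivatives only have to agree with
members of [P] on [U], which suffices because [U] is open. *)
Lemma smooth_on_stable m (U : set 'rV[R]_m) (P : ('rV[R]_m -> R) -> Prop) :
  open U ->
  (forall f, P f -> forall y, U y -> differentiable f y) ->
  (forall f i, P f -> exists2 g, P g & {in U, partial i f =1 g}) ->
  forall f, P f -> smooth_on U f.
Proof.
move=> oU dP pP f Pf y Uy s.
have [g Pg fg] : exists2 g, P g & {in U, foldr (@partial R m) f s =1 g}.
  elim: s => [|i s [g Pg fg]]; first by exists f.
  have [h Ph gh] := pP g i Pg; exists h => // z zU /=.
  rewrite -gh//; apply: near_eq_partial.
  by apply: open_eq_near oU fg _; rewrite -in_setE.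
apply: near_eq_differentiable (dP g Pg y Uy).
by apply: open_eq_near oU _ Uy => z zU; rewrite fg.
Qed.

Lemma smooth_onW m (U V : set 'rV[R]_m) f :
  U `<=` V -> smooth_on V f -> smooth_on U f.
Proof. by move=> UV sf y /UV; exact: sf. Qed.

Lemma smooth_on_diff m (U : set 'rV[R]_m) f y :
  smooth_on U f -> U y -> differentiable f y.
Proof. by move=> sf Uy; exact: (sf y Uy [::]). Qed.

Lemma smooth_on_partial m (U : set 'rV[R]_m) f i :
  smooth_on U f -> smooth_on U (partial i f).
Proof. by move=> sf y Uy s; have := sf y Uy (rcons s i); rewrite foldr_rcons. Qed.

(** The derivative of a product, an inverse or a composite is again built with
sums and products from functions of these forms.  Treating all the operations
at once therefore gives a family to which [smooth_on_stable] applies, and a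
single induction proves all the closure properties. *)
Inductive smooth_expr m (U : set 'rV[R]_m) : ('rV[R]_m -> R) -> Prop :=
| SEbase f : smooth_on U f -> smooth_expr U f
| SEadd f g : smooth_expr U f -> smooth_expr U g -> smooth_expr U (f \+ g)
| SEmul f g : smooth_expr U f -> smooth_expr U g -> smooth_expr U (f \* g)
| SEinv f : smooth_expr U f -> (forall y, U y -> f y != 0) ->
    smooth_expr U (fun y => (f y)^-1)
| SEcomp k (V : set 'rV[R]_k) f (g : 'I_k -> 'rV[R]_m -> R) :
    smooth_on V f -> (forall j, smooth_on U (g j)) ->
    (forall y, U y -> V (\row_j g j y)) ->
    smooth_expr U (fun y => f (\row_j g j y)).

Lemma smooth_on_cst m (U : set 'rV[R]_m) (a : R) : open U -> smooth_on U (cst a).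
Proof.
move=> oU; apply: (@smooth_on_stable _ _ (fun f => exists a, f = cst a)) => //.
- by move=> _ [b ->] y _; exact: differentiable_cst.
- move=> _ i [b ->]; exists (cst 0); first by exists 0.
  by move=> y _; exact: partial_cst.
- by exists a.
Qed.

Lemma smooth_expr_sum m (U : set 'rV[R]_m) k (f : 'I_k -> 'rV[R]_m -> R) :
  open U ->
  (forall j, smooth_expr U (f j)) -> smooth_expr U (fun y => \sum_(j < k) f j y).
Proof.
move=> oU sf; rewrite (_ : (fun y => _) = \sum_(j < k) f j); last first.
  by apply/funext => y; rewrite fct_sumE.
elim/big_ind: _ => //; last by move=> g h; exact: SEadd.
exact/SEbase/(smooth_on_cst 0).
Qed.

Lemma smooth_expr_diff m (U : set 'rV[R]_m) f y :
  smooth_expr U f -> U y -> differentiable f y.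
Proof.
move=> + Uy; elim=> {f} [f sf|f g _ df _ dg|f g _ df _ dg|f _ df f0|k V f g sf sg UV].
- exact: smooth_on_diff sf Uy.
- exact: differentiableD.
- exact: differentiableM.
- by apply: differentiableV => //; exact: f0.
- have dg : differentiable (fun y => \row_j g j y) y.
    by apply: differentiable_row => j; exact: smooth_on_diff Uy.
  apply: (@differentiable_comp _ _ _ _ (fun y => \row_j g j y) f) => //.
  exact/(smooth_on_diff sf)/UV.
Qed.

Lemma smooth_expr_partial m (U : set 'rV[R]_m) f i : open U ->
  smooth_expr U f -> exists2 g, smooth_expr U g & {in U, partial i f =1 g}.
Proof.
move=> oU; elim=> {f} [f sf|f g ef [f' ef' df] eg [g' eg' dg]|
    f g ef [f' ef' df] eg [g' eg' dg]|f ef [f' ef' df] f0|k V f g sf sg UV].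
- by exists (partial i f) => //; exact/SEbase/smooth_on_partial.
- exists (f' \+ g'); first exact: SEadd.
  move=> y yU; have Uy : U y by rewrite -in_setE.
  by rewrite partialD ?df ?dg//; exact: smooth_expr_diff Uy.
- exists ((f \* g') \+ (g \* f')); first by apply: SEadd; exact: SEmul.
  move=> y yU; have Uy : U y by rewrite -in_setE.
  by rewrite partialM ?df ?dg//; exact: smooth_expr_diff Uy.
- exists ((cst (-1) \* ((fun y => (f y)^-1) \* (fun y => (f y)^-1))) \* f').
    apply: SEmul => //; apply: SEmul; last by apply: SEmul; exact: SEinv.
    exact/SEbase/smooth_on_cst.
  move=> y yU; have Uy : U y by rewrite -in_setE.
  by rewrite partialV ?df ?f0//= ?mulN1r//; exact: smooth_expr_diff Uy.
- exists (fun y => \sum_(j < k) partial j f (\row_j g j y) * partial i (g j) y).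
    apply: smooth_expr_sum => // j; apply: SEmul.
      by apply: (@SEcomp _ _ _ V) => //; exact: smooth_on_partial.
    exact/SEbase/smooth_on_partial.
  move=> y yU; have Uy : U y by rewrite -in_setE.
  rewrite partial_comp// => [j|]; first exact: smooth_on_diff Uy.
  exact/(smooth_on_diff sf)/UV.
Qed.

Lemma smooth_expr_on m (U : set 'rV[R]_m) f :
  open U -> smooth_expr U f -> smooth_on U f.
Proof.
move=> oU; apply: smooth_on_stable => // {}f; first by move=> ef y; exact: smooth_expr_diff.
by move=> i; exact: smooth_expr_partial.
Qed.

Section SmoothNear.
Variables (m : nat) (y : 'rV[R]_m).
Implicit Types f g : 'rV[R]_m -> R.

(** The functions that agree with a smooth one on an open set are stable under
partial derivatives. *)
Lemma smooth_near_eq f g :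
  (\near y, f y = g y) -> smooth_near y f -> smooth_near y g.
Proof.
move=> /near_openP[U [oU Uy] fg] /smooth_nearP[V [oV Vy] sf].
apply/smooth_nearP; exists (U `&` V); first by split => //; exact: openI.
have oUV : open (U `&` V) by exact: openI.
apply: (@smooth_on_stable _ _ (fun h => exists2 f, smooth_on V f & {in U `&` V, f =1 h}))
   => //.
- move=> h [k sk kh] z UVz.
  apply: near_eq_differentiable (smooth_on_diff sk UVz.2).
  exact: open_eq_near UVz.
- move=> h i [k sk kh]; exists (partial i k).
    by exists (partial i k) => //; exact: smooth_on_partial.
  move=> z; rewrite inE => UVz; apply/near_eq_partial.
  by apply: open_eq_near UVz => // w ?; rewrite kh.
- by exists f => // z; rewrite inE => -[/fg].
Qed.

Lemma smooth_near_expr f :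
  (exists2 U, open U /\ U y & smooth_expr U f) -> smooth_near y f.
Proof.
move=> [U [oU Uy] ef]; apply/smooth_nearP; exists U => //.
exact: smooth_expr_on.
Qed.

Lemma smooth_near_cst (a : R) : smooth_near y (cst a).
Proof.
by apply/smooth_nearP; exists setT; [split; [exact: openT|]|apply/smooth_on_cst/openT].
Qed.

Lemma smooth_nearD f g :
  smooth_near y f -> smooth_near y g -> smooth_near y (f \+ g).
Proof.
move=> /smooth_nearP[U [oU Uy] sf] /smooth_nearP[V [oV Vy] sg].
apply: smooth_near_expr; exists (U `&` V); first by split => //; exact: openI.
apply: SEadd; apply: SEbase.
  exact: smooth_onW (@subIsetl _ _ _) sf.
exact: smooth_onW (@subIsetr _ _ _) sg.
Qed.

Lemma smooth_nearM f g :
  smooth_near y f -> smooth_near y g -> smooth_near y (f \* g).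
Proof.
move=> /smooth_nearP[U [oU Uy] sf] /smooth_nearP[V [oV Vy] sg].
apply: smooth_near_expr; exists (U `&` V); first by split => //; exact: openI.
apply: SEmul; apply: SEbase.
  exact: smooth_onW (@subIsetl _ _ _) sf.
exact: smooth_onW (@subIsetr _ _ _) sg.
Qed.

Lemma smooth_near_diff f : smooth_near y f -> differentiable f y.
Proof. by move=> /smooth_nearP[U [oU Uy] sf]; exact: smooth_on_diff sf Uy. Qed.

Lemma smooth_near_partial f i : smooth_near y f -> smooth_near y (partial i f).
Proof.
move=> /smooth_nearP[U oU sf]; apply/smooth_nearP; exists U => //.
exact: smooth_on_partial.
Qed.

Lemma smooth_nearV f : f y != 0 ->
  smooth_near y f -> smooth_near y (fun y => (f y)^-1).
Proof.
move=> f0 sf; have fc := differentiable_continuous (smooth_near_diff sf).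
have : \forall z \near y, f z != 0 by exact: cvgr_neq0 fc f0.
move=> /near_openP[V [oV Vy] Vf]; case/smooth_nearP: sf => U [oU Uy] sf.
apply: smooth_near_expr; exists (U `&` V); first by split => //; exact: openI.
apply: SEinv; last by move=> z [_ /Vf].
by apply: SEbase; apply: smooth_onW sf => ? [].
Qed.

Lemma smooth_near_near f :
  smooth_near y f -> \forall z \near y, smooth_near z f.
Proof. exact: nbhs_interior. Qed.

Lemma smooth_near_coord j : smooth_near y (fun y => y 0 j).
Proof.
apply/smooth_nearP; exists setT; first by split; [exact: openT|].
apply: (@smooth_on_stable _ _
  (fun f => f = (fun y => y 0 j) \/ exists a, f = cst a)); first exact: openT.
- move=> f [|[a]] -> z _; [exact: differentiable_coord|exact: differentiable_cst].
- move=> f i [|[a]] ->.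
    exists (cst (i == j)%:R); first by right; exists (i == j)%:R.
    by move=> z _; rewrite partial_coord.
  exists (cst 0); first by right; exists 0.
  by move=> z _; rewrite partial_cst.
- by left.
Qed.

End SmoothNear.

Lemma smooth_near_prod m (y : 'rV[R]_m) (I : Type) (r : seq I)
    (F : I -> 'rV[R]_m -> R) :
  (forall i, smooth_near y (F i)) -> smooth_near y (fun z => \prod_(i <- r) F i z).
Proof.
move=> sF; elim: r => [|i r IH].
  by under eq_fun do rewrite big_nil; exact: smooth_near_cst.
by under eq_fun do rewrite big_cons; exact: (smooth_nearM (sF i) IH).
Qed.

Lemma smooth_near_comp m k (f : 'rV[R]_k -> R) (g : 'I_k -> 'rV[R]_m -> R) y :
  (forall j, smooth_near y (g j)) -> smooth_near (\row_j g j y) f ->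
  smooth_near y (fun y => f (\row_j g j y)).
Proof.
move=> sg /smooth_nearP[V [oV Vy] sf].
have gc : {for y, continuous (fun y => \row_j g j y : 'rV[R]_k)}.
  apply/differentiable_continuous/differentiable_row => j.
  exact/smooth_near_diff.
have {Vy} Vg : \forall z \near y, V (\row_j g j z).
  by apply: gc; exact: open_nbhs_nbhs.
have : \forall z \near y, forall j s, differentiable (foldr (@partial R m) (g j) s) z.
  exact: (@filter_forall _ _ (fun j => [set z | forall s,
    differentiable (foldr (@partial R m) (g j) s) z]) _ _ sg).
move=> /(filterI Vg)/near_openP[U oU UV].
apply: smooth_near_expr; exists U => //; apply: (@SEcomp _ _ _ V) => //.
  by move=> j z /UV[_ /(_ j)].
by move=> z /UV[].
Qed.

(** * Symmetry of second derivatives *)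

Lemma is_derive_line (V : normedModType R) (f : V -> R) (p v : V) (s : R) :
  differentiable f (p + s *: v) ->
  is_derive s 1 (fun s => f (p + s *: v)) ('D_v f (p + s *: v)).
Proof.
move=> df; pose G (s : R) := p + s *: v.
have dG : is_diff s G (0 + ( *:%R^~ v)) by exact: is_diffD.
have dfG : differentiable (f \o G) s by apply: differentiable_comp => //; exact: ex_diff.
apply: DeriveDef; first exact: diff_derivable.
rewrite -[fun _ => _]/(f \o G) (deriveE _ dfG) diff_comp//.
by rewrite /= (diff_val (is_diff_def := dG)) /= add0r scale1r deriveE.
Qed.

Lemma MVT_line (f df : R -> R) (h : R) : 0 < h ->
  (forall x, x \in `[0, h] -> is_derive x 1 f (df x)) ->
  exists2 c, c \in `]0, h[ & f h - f 0 = df c * h.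
Proof.
move=> h0 fdf.
have d1 x : x \in `]0, h[ -> is_derive x 1 f (df x).
  by move=> xh; apply: fdf; exact: subset_itv_oo_cc.
have cf : {within `[0, h], continuous f}.
  apply: derivable_within_continuous => x xh.
  by have dx := fdf x xh; exact: ex_derive.
by have [c ch E] := MVT h0 d1 cf; exists c => //; rewrite E subr0.
Qed.

(** The mean value theorem is used twice: along [u] for the increment of [f] in
the direction [v], then along [v] for the derivative of [f] in the direction
[u].  The left-hand side is symmetric in [u] and [v], so that exchanging them
compares the two mixed derivatives at points close to [p]. *)
Lemma second_difference (V : normedModType R) (f : V -> R) (p u v : V) (h : R) :
  0 < h ->
  (forall c d, c \in `[0, h] -> d \in `[0, h] ->
     differentiable f (p + c *: u + d *: v) /\
     differentiable ('D_u f) (p + c *: u + d *: v)) ->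
  exists c d, [/\ c \in `[0, h], d \in `[0, h] &
    f (p + h *: u + h *: v) - f (p + h *: u) - f (p + h *: v) + f p =
    'D_v ('D_u f) (p + c *: u + d *: v) * h * h].
Proof.
move=> h0 df.
have h_in : h \in `[0, h] by rewrite in_itv/= lexx ltW.
have z_in : 0 \in `[0, h] by rewrite in_itv/= lexx ltW.
have [|c ch /= Ec] := @MVT_line (fun s => f (p + h *: v + s *: u) - f (p + s *: u))
  (fun s => 'D_u f (p + h *: v + s *: u) - 'D_u f (p + s *: u)) h h0.
  move=> x xh; have [d1 _] := df x h xh h_in; have [d2 _] := df x 0 xh z_in.
  rewrite addrAC in d1; rewrite scale0r addr0 in d2.
  apply: is_deriveB; exact: is_derive_line.
have {}ch : c \in `[0, h] by exact: subset_itv_oo_cc.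
have [|d dh /= Ed] := @MVT_line (fun s => 'D_u f (p + c *: u + s *: v))
  (fun s => 'D_v ('D_u f) (p + c *: u + s *: v)) h h0.
  by move=> x xh; apply: is_derive_line; have [] := df c x ch xh.
exists c, d; split => //; first exact: subset_itv_oo_cc.
rewrite -Ed scale0r addr0 [p + c *: u + _]addrAC -Ec !scale0r !addr0.
by rewrite [p + h *: v + _]addrAC opprB addrA addrAC.
Qed.

Lemma halves_dist (a b w e : R) :
  `|a - w| < e / 2 -> `|b - w| < e / 2 -> `|a - b| <= e.
Proof.
move=> /ltW A1 /ltW A2; rewrite (splitr e) -(subrKA w).
by rewrite (le_trans (ler_normD _ _))// lerD// distrC.
Qed.

(** Over parallelograms of side [h] the second difference is [h * h] times a
value of either mixed derivative; both are continuous, so they agree at [y]. *)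
Lemma partialC m (f : 'rV[R]_m -> R) i j y : smooth_near y f ->
  partial i (partial j f) y = partial j (partial i f) y.
Proof.
move=> sf; set u : 'rV[R]_m := delta_mx 0 i; set v : 'rV[R]_m := delta_mx 0 j.
have cont k l : {for y, continuous (partial k (partial l f))}.
  by apply/differentiable_continuous/smooth_near_diff; do 2!apply: smooth_near_partial.
apply/eqP; rewrite -subr_eq0 -normr_le0; apply/ler_addgt0Pl => e e0.
have e2 : 0 < e / 2 by rewrite divr_gt0.
have nd k l : \forall z \near y,
    `|partial k (partial l f) y - partial k (partial l f) z| < e / 2.
  by move/cvgrPdist_lt: (cont k l) => /(_ _ e2).
have : \forall z \near y,
  [/\ forall s, differentiable (foldr (@partial R m) f s) z,
  `|partial i (partial j f) y - partial i (partial j f) z| < e / 2 &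
  `|partial j (partial i f) y - partial j (partial i f) z| < e / 2].
  by apply: filterS3 sf (nd i j) (nd j i) => z ? ? ?; split.
rewrite -[X in X -> _]/(nbhs y _) => /nbhs_ballP[r /= r0 yr].
(* The parallelogram of side [h] stays in the ball of radius [r]. *)
pose h := r / (`|u| + `|v| + 1).
have k0 : 0 < `|u| + `|v| + 1 by rewrite ltr_wpDl// addr_ge0.
have h0 : 0 < h by rewrite divr_gt0.
have in_ball c d : c \in `[0, h] -> d \in `[0, h] ->
    ball y r (y + c *: u + d *: v).
  rewrite !in_itv/= => /andP[c0 ch] /andP[d0 dh].
  have -> : y + c *: u + d *: v = y + (c *: u + d *: v) by rewrite addrA.
  rewrite -ball_normE /= opprD addNKr normrN.
  have : `|c *: u + d *: v| <= h * `|u| + h * `|v|.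
    rewrite (le_trans (ler_normD _ _))// !normrZ !ger0_norm//.
    by rewrite lerD// ler_wpM2r.
  move=> /le_lt_trans; apply; rewrite -mulrDr /h mulrAC ltr_pdivrMr//.
  by rewrite ltr_pM2l// ltrDl.
have [|c [d [ch dh E]]] := @second_difference _ f y u v h h0.
  move=> c d ch dh; have [s1 _ _] := yr _ (in_ball c d ch dh).
  by split; [exact: (s1 [::])|exact: (s1 [:: i])].
have [|d' [c' [d'h c'h E']]] := @second_difference _ f y v u h h0.
  move=> d' c' d'h c'h.
  have -> : y + d' *: v + c' *: u = y + c' *: u + d' *: v by rewrite addrAC.
  have [s1 _ _] := yr _ (in_ball c' d' c'h d'h).
  by split; [exact: (s1 [::])|exact: (s1 [:: j])].
have [_ _ A1] := yr _ (in_ball c d ch dh).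
have [_ A2 _] := yr _ (in_ball c' d' c'h d'h).
rewrite addr0; set a := partial i _ y in A2 *; set b := partial j _ y in A1 *.
suff EE : partial i (partial j f) (y + c' *: u + d' *: v) =
          partial j (partial i f) (y + c *: u + d *: v).
  by rewrite EE in A2; exact: halves_dist A2 A1.
apply/(mulIf (lt0r_neq0 h0))/(mulIf (lt0r_neq0 h0)).
have C1 : y + d' *: v + c' *: u = y + c' *: u + d' *: v := addrAC _ _ _.
have C2 : y + h *: v + h *: u = y + h *: u + h *: v := addrAC _ _ _.
rewrite C1 C2 in E'; apply: etrans (esym E') (etrans _ E).
by congr (_ + _); exact: addrAC.
Qed.

End EuclideanCalculus.

(** * Calculus in the charts of an atlas *)

Lemma local_rep_coord (R : realType) (T : Type) (m : nat) (c : chart R T m) x f :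
  {in dom c &, injective (coord c)} -> dom c x ->
  local_rep c f (coord c x) = f x.
Proof.
move=> c_inj dx; rewrite /local_rep.
have -> : f @` [set x' | dom c x' /\ coord c x' = coord c x] = [set f x].
  apply/seteqP; split => [_ [x' [dx' E] <-]|_ ->]; last by exists x.
  by rewrite (c_inj x' x)// inE.
exact: (xgetPex 0 (ex_intro [set f x] (f x) erefl)).
Qed.

Section AtlasCalculus.
Variables (R : realType) (T : Type) (m : nat) (A : set (chart R T m)).

(** What the calculus needs from an atlas.  [T] carries no topology, so that the
conditions apply to the slit cotangent bundle as well as to the base; openness
is expressed by points near the coordinates of a given point. *)
Record good_atlas : Prop := GoodAtlas {
  ga_inj : forall c, A c -> {in dom c &, injective (coord c)};
  ga_overlap : forall c c' x, A c -> A c' -> dom c x -> dom c' x ->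
    \forall y \near coord c x, exists x', [/\ dom c x', dom c' x' & coord c x' = y];
  ga_cover : forall x, exists2 c, A c & dom c x;
  ga_compat : forall c c', A c -> A c' -> compatible c c' }.

Hypothesis ga : good_atlas.
Implicit Types (c : chart R T m) (x : T) (f g : T -> R).

(** The neighbourhood filter of [x], read in the charts. *)
Definition around x (P : T -> Prop) : Prop :=
  forall c, A c -> dom c x ->
    \forall y \near coord c x, forall x', dom c x' -> coord c x' = y -> P x'.

Lemma coord_inj c x x' : A c -> dom c x -> dom c x' ->
  coord c x = coord c x' -> x = x'.
Proof. by move=> Ac dx dx'; apply: (ga_inj ga Ac); rewrite inE. Qed.

Lemma local_repE c x f : A c -> dom c x -> local_rep c f (coord c x) = f x.
Proof. by move=> Ac; exact/local_rep_coord/(ga_inj ga). Qed.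

(** Near a common point, a function read in one chart is the composite of the
function read in the other chart with the change of coordinates. *)
Lemma near_transition c c' x f : A c -> A c' -> dom c x -> dom c' x ->
  \forall y \near coord c x,
    local_rep c f y = local_rep c' f (\row_j local_rep c (coordf c' j) y).
Proof.
move=> Ac Ac' dx dx'; apply: filterS (ga_overlap ga Ac Ac' dx dx').
move=> _ [z [dz dz' <-]]; rewrite local_repE//.
rewrite (_ : \row_j _ = coord c' z) ?local_repE//.
by apply/rowP => j; rewrite mxE local_repE.
Qed.

Lemma transition_center c c' x : A c -> A c' -> dom c x -> dom c' x ->
  \row_j local_rep c (coordf c' j) (coord c x) = coord c' x.
Proof.
by move=> Ac Ac' dx dx'; apply/rowP => j; rewrite mxE local_repE.
Qed.

(** One chart is enough to test smoothness, since changes of coordinates are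
smooth. *)
Lemma smooth_at_chart c x f : A c -> dom c x ->
  smooth_near (coord c x) (local_rep c f) -> smooth_at A x f.
Proof.
move=> Ac dx sf c' Ac' dx'.
apply: (@smooth_near_eq _ _ _
  (fun y => local_rep c f (\row_j local_rep c' (coordf c j) y))).
  by have := near_transition f Ac' Ac dx' dx; apply: filterS => y ->.
apply: smooth_near_comp; first by move=> j; exact: (ga_compat ga Ac' Ac).
by rewrite transition_center.
Qed.

Lemma transition_continuous c c' x : A c -> A c' -> dom c x -> dom c' x ->
  {for coord c x, continuous (fun y => \row_j local_rep c (coordf c' j) y)}.
Proof.
move=> Ac Ac' dx dx'; apply/differentiable_continuous/differentiable_row => j.
exact/smooth_near_diff/(ga_compat ga Ac Ac').
Qed.

(** One chart is enough to test a neighbourhood, since changes of coordinates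
are continuous. *)
Lemma around_chart c x P : A c -> dom c x ->
  (\forall y \near coord c x, forall x', dom c x' -> coord c x' = y -> P x') ->
  around x P.
Proof.
move=> Ac dx cP c' Ac' dx'.
have tc := transition_continuous Ac' Ac dx' dx.
have {tc}cP' : \forall y \near coord c' x, forall x', dom c x' ->
    coord c x' = \row_j local_rep c' (coordf c j) y -> P x'.
  move: cP; rewrite -(transition_center Ac' Ac dx' dx).
  exact: (tc [set w | forall x', dom c x' -> coord c x' = w -> P x']).
apply: filterS2 cP' (ga_overlap ga Ac' Ac dx' dx).
move=> y Hy [z [dz' dz E]] z' dz'2 E'.
rewrite (@coord_inj c' z' z)// ?E//; apply: Hy => //.
by rewrite -E transition_center.
Qed.

Lemma around_dom c x : A c -> dom c x -> around x (dom c).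
Proof.
move=> Ac dx c' Ac' dx'; apply: filterS (ga_overlap ga Ac' Ac dx' dx).
by move=> _ [z [dz' dz <-]] z' dz2 /(coord_inj Ac' dz2 dz') ->.
Qed.

Lemma aroundI x P Q : around x P -> around x Q -> around x (fun z => P z /\ Q z).
Proof.
move=> xP xQ c Ac dx; apply: filterS2 (xP c Ac dx) (xQ c Ac dx) => y Py Qy z dz E.
by split; [exact: Py|exact: Qy].
Qed.

Lemma aroundS x (P Q : T -> Prop) : (forall z, P z -> Q z) -> around x P -> around x Q.
Proof.
move=> PQ xP c Ac dx; apply: filterS (xP c Ac dx) => y Py z dz E.
exact/PQ/Py.
Qed.

Lemma aroundT x (P : T -> Prop) : (forall z, P z) -> around x P.
Proof.
move=> PT c Ac dx; apply/near_openP; exists setT => //.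
by split => //; exact: openT.
Qed.

Lemma around_self x P : around x P -> P x.
Proof.
move=> xP; have [c Ac dx] := ga_cover ga x.
by have /nbhs_singleton := xP c Ac dx; exact.
Qed.

Lemma around_domS c x (P : T -> Prop) : A c -> dom c x ->
  (forall z, dom c z -> P z) -> around x P.
Proof. by move=> Ac dx dP; apply: aroundS (around_dom Ac dx). Qed.

Lemma around_smooth x f : smooth_at A x f -> around x (fun z => smooth_at A z f).
Proof.
move=> sf; have [c Ac dx] := ga_cover ga x; apply: (around_chart Ac dx).
apply: filterS (smooth_near_near (sf c Ac dx)) => y sy z dz E.
by apply: (smooth_at_chart Ac dz); rewrite E.
Qed.

Lemma near_local_rep x c (P : R -> R -> Prop) f g : A c -> dom c x ->
  around x (fun z => P (f z) (g z)) ->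
  \forall y \near coord c x, P (local_rep c f y) (local_rep c g y).
Proof.
move=> Ac dx xP; apply: filterS2 (xP c Ac dx) (ga_overlap ga Ac Ac dx dx).
by move=> y Py [z [dz _ E]]; rewrite -E !local_repE//; exact: (Py z dz E).
Qed.

Lemma near_local_rep_fun x c f (F : 'rV[R]_m -> R) : A c -> dom c x ->
  around x (fun z => dom c z -> F (coord c z) = f z) ->
  \forall y \near coord c x, F y = local_rep c f y.
Proof.
move=> Ac dx xP; apply: filterS2 (xP c Ac dx) (ga_overlap ga Ac Ac dx dx).
by move=> y Py [z [dz _ E]]; rewrite -E !local_repE//; exact: (Py z dz E dz).
Qed.

Lemma smooth_at_fun x c f (F : 'rV[R]_m -> R) : A c -> dom c x ->
  around x (fun z => dom c z -> F (coord c z) = f z) ->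
  smooth_near (coord c x) F -> smooth_at A x f.
Proof.
move=> Ac dx xP sF; apply: (smooth_at_chart Ac dx).
by apply: smooth_near_eq sF; exact: near_local_rep_fun.
Qed.

Lemma smooth_at_eq x f g : around x (fun z => f z = g z) ->
  smooth_at A x f -> smooth_at A x g.
Proof.
move=> fg sf c Ac dx; apply: smooth_near_eq (sf c Ac dx).
exact: near_local_rep fg.
Qed.

Lemma smooth_at_cst x (a : R) : smooth_at A x (fun=> a).
Proof.
have [c Ac dx] := ga_cover ga x.
apply: (smooth_at_fun Ac dx _ (smooth_near_cst (coord c x) a)).
exact: aroundT.
Qed.

Lemma smooth_atD x f g : smooth_at A x f -> smooth_at A x g ->
  smooth_at A x (fun z => f z + g z).
Proof.
move=> sf sg; have [c Ac dx] := ga_cover ga x.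
apply: (smooth_at_fun Ac dx _ (smooth_nearD (sf c Ac dx) (sg c Ac dx))).
by apply: aroundT => z dz /=; rewrite !local_repE.
Qed.

Lemma smooth_atM x f g : smooth_at A x f -> smooth_at A x g ->
  smooth_at A x (fun z => f z * g z).
Proof.
move=> sf sg; have [c Ac dx] := ga_cover ga x.
apply: (smooth_at_fun Ac dx _ (smooth_nearM (sf c Ac dx) (sg c Ac dx))).
by apply: aroundT => z dz /=; rewrite !local_repE.
Qed.

Lemma smooth_atN x f : smooth_at A x f -> smooth_at A x (fun z => - f z).
Proof.
move=> sf; apply: (smooth_at_eq _ (smooth_atM (smooth_at_cst (-1)) sf)).
by apply: aroundT => z; rewrite mulN1r.
Qed.

Lemma smooth_atB x f g : smooth_at A x f -> smooth_at A x g ->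
  smooth_at A x (fun z => f z - g z).
Proof. by move=> sf sg; apply: smooth_atD => //; exact: smooth_atN. Qed.

Lemma smooth_atV x f : f x != 0 -> smooth_at A x f ->
  smooth_at A x (fun z => (f z)^-1).
Proof.
move=> f0 sf; have [c Ac dx] := ga_cover ga x.
have f0' : local_rep c f (coord c x) != 0 by rewrite local_repE.
apply: (smooth_at_fun Ac dx _ (smooth_nearV f0' (sf c Ac dx))).
by apply: aroundT => z dz /=; rewrite !local_repE.
Qed.

Lemma smooth_at_sum x (I : Type) (r : seq I) (P : pred I) (F : I -> T -> R) :
  (forall i, P i -> smooth_at A x (F i)) ->
  smooth_at A x (fun z => \sum_(i <- r | P i) F i z).
Proof.
move=> sF; have -> : (fun z => \sum_(i <- r | P i) F i z) = \sum_(i <- r | P i) F i.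
  by apply/funext => z; rewrite fct_sumE.
elim/big_ind: _ => [|f g|i Pi]; first exact: smooth_at_cst.
  exact: smooth_atD.
exact: sF.
Qed.

Lemma smooth_at_prod x (I : Type) (r : seq I) (P : pred I) (F : I -> T -> R) :
  (forall i, P i -> smooth_at A x (F i)) ->
  smooth_at A x (fun z => \prod_(i <- r | P i) F i z).
Proof.
move=> sF; elim: r => [|i r IH].
  apply: (smooth_at_eq _ (smooth_at_cst 1)).
  by apply: aroundT => z; rewrite big_nil.
have [Pi|Pi] := boolP (P i).
  apply: (smooth_at_eq _ (smooth_atM (sF i Pi) IH)).
  by apply: aroundT => z; rewrite big_cons Pi.
apply: (smooth_at_eq _ IH).
by apply: aroundT => z; rewrite big_cons (negPf Pi).
Qed.

Lemma smooth_at_coordf c x i : A c -> dom c x -> smooth_at A x (coordf c i).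
Proof. by move=> Ac dx c' Ac' dx'; exact: (ga_compat ga Ac' Ac). Qed.

Lemma around_eq_smooth x f g : around x (fun z => f z = g z) ->
  smooth_at A x f <-> smooth_at A x g.
Proof.
move=> fg; split; apply: smooth_at_eq => //.
by apply: aroundS fg => z ->.
Qed.

Lemma around_neq0 x f : smooth_at A x f -> f x != 0 ->
  around x (fun z => f z != 0).
Proof.
move=> sf f0; have [c Ac dx] := ga_cover ga x; apply: (around_chart Ac dx).
have fc := differentiable_continuous (smooth_near_diff (sf c Ac dx)).
have f0' : local_rep c f (coord c x) != 0 by rewrite local_repE.
have : \forall y \near coord c x, local_rep c f y != 0 by exact: cvgr_neq0 fc f0'.
apply: filterS => y fy z dz E.
by rewrite -(local_repE f Ac dz) E.
Qed.

(** * Tangent vectors as derivations *)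

Lemma coord_vecE c i x f : smooth_at A x f ->
  coord_vec A c i x f = partial i (local_rep c f) (coord c x).
Proof. by move=> sf; rewrite /coord_vec; case: asboolP. Qed.

Lemma coord_vec_nsmooth c i x f : ~ smooth_at A x f -> coord_vec A c i x f = 0.
Proof. by move=> sf; rewrite /coord_vec; case: asboolP. Qed.

Lemma coord_vec_eq c i x f g : A c -> dom c x ->
  around x (fun z => f z = g z) -> coord_vec A c i x f = coord_vec A c i x g.
Proof.
move=> Ac dx fg; rewrite /coord_vec (asbool_equiv_eq (around_eq_smooth fg)).
case: asboolP => // _; apply: near_eq_partial.
exact: near_local_rep fg.
Qed.

Lemma coord_vecD c i x f g : A c -> dom c x ->
  smooth_at A x f -> smooth_at A x g ->
  coord_vec A c i x (fun z => f z + g z) =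
  coord_vec A c i x f + coord_vec A c i x g.
Proof.
move=> Ac dx sf sg; rewrite !coord_vecE//; last exact: smooth_atD.
rewrite -partialD; [|exact/smooth_near_diff/sf|exact/smooth_near_diff/sg].
apply/esym/near_eq_partial/near_local_rep_fun => //.
by apply: aroundT => z dz /=; rewrite !local_repE.
Qed.

Lemma coord_vecM c i x f g : A c -> dom c x ->
  smooth_at A x f -> smooth_at A x g ->
  coord_vec A c i x (fun z => f z * g z) =
  f x * coord_vec A c i x g + g x * coord_vec A c i x f.
Proof.
move=> Ac dx sf sg; rewrite !coord_vecE//; last exact: smooth_atM.
rewrite -[X in X * _](local_repE f Ac dx) -[X in _ + X * _](local_repE g Ac dx).
rewrite -partialM; [|exact/smooth_near_diff/sf|exact/smooth_near_diff/sg].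
apply/esym/near_eq_partial/near_local_rep_fun => //.
by apply: aroundT => z dz /=; rewrite !local_repE.
Qed.

Lemma coord_vec_cst c i x (a : R) : A c -> dom c x ->
  coord_vec A c i x (fun=> a) = 0.
Proof.
move=> Ac dx; rewrite coord_vecE; last exact: smooth_at_cst.
rewrite -(partial_cst i a (coord c x)).
apply/esym/near_eq_partial/near_local_rep_fun => //; exact: aroundT.
Qed.

Lemma coord_vec_coordf c i j x : A c -> dom c x ->
  coord_vec A c i x (coordf c j) = (i == j)%:R.
Proof.
move=> Ac dx; rewrite coord_vecE; last exact: smooth_at_coordf.
rewrite -(partial_coord i j (coord c x)).
by apply/esym/near_eq_partial/near_local_rep_fun => //; exact: aroundT.
Qed.

Lemma functional_sumE (I : Type) (r : seq I) (P : pred I) (a : I -> R)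
    (v : I -> functional R T) f :
  (\sum_(i <- r | P i) a i *: v i) f = \sum_(i <- r | P i) a i * v i f.
Proof. by rewrite fct_sumE. Qed.

(** The chain rule: in any chart a coordinate vector has its values on the
coordinate functions as components. *)
Lemma coord_vec_change c c' i x : A c -> A c' -> dom c x -> dom c' x ->
  coord_vec A c' i x =
  \sum_(j < m) coord_vec A c' i x (coordf c j) *: coord_vec A c j x.
Proof.
move=> Ac Ac' dx dx'; apply/funext => f; rewrite functional_sumE.
have [sf|sf] := pselect (smooth_at A x f); last first.
  rewrite coord_vec_nsmooth// big1// => j _.
  by rewrite (coord_vec_nsmooth _ _ sf) mulr0.
rewrite (coord_vecE _ _ sf).
rewrite (near_eq_partial _ (near_transition f Ac' Ac dx' dx)).
rewrite partial_comp; last 2 first.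
- by move=> j; exact/smooth_near_diff/(ga_compat ga Ac' Ac).
- by rewrite transition_center//; exact/smooth_near_diff/sf.
apply: eq_bigr => j _; rewrite mulrC transition_center//.
by rewrite (coord_vecE _ _ sf) coord_vecE//; exact: smooth_at_coordf.
Qed.

Lemma coord_vec_smooth c i x f : A c -> dom c x ->
  smooth_at A x f -> smooth_at A x (fun z => coord_vec A c i z f).
Proof.
move=> Ac dx sf.
apply: (smooth_at_fun Ac dx _ (smooth_near_partial i (sf c Ac dx))).
by apply: aroundS (around_smooth sf) => z sz dz; rewrite coord_vecE.
Qed.

(** Coordinate fields commute, which is what makes brackets derivations. *)
Lemma coord_vecC c i j x f : A c -> dom c x -> smooth_at A x f ->
  coord_vec A c i x (fun z => coord_vec A c j z f) =
  coord_vec A c j x (fun z => coord_vec A c i z f).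
Proof.
move=> Ac dx sf; rewrite !coord_vecE; try exact: coord_vec_smooth.
have H k : \forall y \near coord c x,
    partial k (local_rep c f) y = local_rep c (fun z => coord_vec A c k z f) y.
  apply: near_local_rep_fun => //.
  by apply: aroundS (around_smooth sf) => z sz dz; rewrite coord_vecE.
rewrite -(near_eq_partial _ (H i)) -(near_eq_partial _ (H j)).
by rewrite partialC//; exact: sf.
Qed.

Lemma tangent_sum_coord c x (a : 'I_m -> R) : A c -> dom c x ->
  tangent A x (\sum_(i < m) a i *: coord_vec A c i x).
Proof. by move=> Ac dx; exists c, a. Qed.

(** Hence tangent vectors are determined by their values on the coordinate
functions of one chart, whatever chart was used to build them. *)
Lemma tangent_expand c x v : A c -> dom c x -> tangent A x v ->
  v = \sum_(j < m) v (coordf c j) *: coord_vec A c j x.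
Proof.
move=> Ac dx [c' [a [Ac' dx' ->]]].
under [RHS]eq_bigr => j _ do rewrite functional_sumE scaler_suml.
rewrite exchange_big/=; apply: eq_bigr => i _.
rewrite (coord_vec_change i Ac Ac' dx dx') {1}scaler_sumr.
apply: eq_bigr => j _; rewrite scalerA.
by rewrite -(coord_vec_change i Ac Ac' dx dx').
Qed.

Lemma tangent_eq c x v w : A c -> dom c x -> tangent A x v -> tangent A x w ->
  (forall j, v (coordf c j) = w (coordf c j)) -> v = w.
Proof.
move=> Ac dx tv tw vw; rewrite (tangent_expand Ac dx tv) (tangent_expand Ac dx tw).
by apply: eq_bigr => j _; rewrite vw.
Qed.

Lemma tangentPZ (a : R) x v w : tangent A x v -> tangent A x w ->
  tangent A x (a *: v + w).
Proof.
have [c Ac dx] := ga_cover ga x => tv tw.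
rewrite (tangent_expand Ac dx tv) (tangent_expand Ac dx tw).
rewrite scaler_sumr -big_split/=.
under eq_bigr => i _ do rewrite scalerA -scalerDl.
exact: tangent_sum_coord.
Qed.

Lemma tangent0 x : tangent A x 0.
Proof.
have [c Ac dx] := ga_cover ga x.
rewrite (_ : 0 = \sum_(i < m) 0 *: coord_vec A c i x); last first.
  by rewrite big1// => i _; rewrite scale0r.
exact: tangent_sum_coord.
Qed.

Lemma tangentD x v w : tangent A x v -> tangent A x w -> tangent A x (v + w).
Proof. by move=> tv tw; have := tangentPZ 1 tv tw; rewrite scale1r. Qed.

Lemma tangentZ (a : R) x v : tangent A x v -> tangent A x (a *: v).
Proof. by move=> tv; have := tangentPZ a tv (tangent0 x); rewrite addr0. Qed.

Lemma tangentN x v : tangent A x v -> tangent A x (- v).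
Proof. by move=> tv; rewrite -scaleN1r; exact: tangentZ. Qed.

Lemma tangentB x v w : tangent A x v -> tangent A x w -> tangent A x (v - w).
Proof. by move=> tv tw; apply: tangentD => //; exact: tangentN. Qed.

Lemma tangent_sum x (I : Type) (r : seq I) (P : pred I) (a : I -> R)
    (v : I -> functional R T) : (forall i, P i -> tangent A x (v i)) ->
  tangent A x (\sum_(i <- r | P i) a i *: v i).
Proof.
move=> tv; elim/big_ind: _ => [|v1 v2|i Pi]; first exact: tangent0.
- exact: tangentD.
- exact/tangentZ/tv.
Qed.

Lemma tangent_coord_vec c i x : A c -> dom c x -> tangent A x (coord_vec A c i x).
Proof.
move=> Ac dx; rewrite (_ : coord_vec _ _ _ _ =
  \sum_(j < m) (j == i)%:R *: coord_vec A c j x); first exact: tangent_sum_coord.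
rewrite (bigD1 i)//= eqxx scale1r big1 ?addr0// => j /negPf ->.
by rewrite scale0r.
Qed.

Lemma tangent_app c x v f : A c -> dom c x -> tangent A x v ->
  v f = \sum_(j < m) v (coordf c j) * coord_vec A c j x f.
Proof.
by move=> Ac dx tv; rewrite {1}(tangent_expand Ac dx tv) functional_sumE.
Qed.

Lemma tangent_nsmooth x v f : tangent A x v -> ~ smooth_at A x f -> v f = 0.
Proof.
move=> tv sf; have [c Ac dx] := ga_cover ga x.
rewrite (tangent_app _ Ac dx tv) big1// => j _.
by rewrite coord_vec_nsmooth ?mulr0.
Qed.

Lemma tangent_germ x v f g : tangent A x v -> around x (fun z => f z = g z) ->
  v f = v g.
Proof.
move=> tv fg; have [c Ac dx] := ga_cover ga x.
rewrite !(tangent_app _ Ac dx tv); apply: eq_bigr => j _.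
by rewrite (coord_vec_eq j Ac dx fg).
Qed.

Lemma tangentDr x v f g : tangent A x v -> smooth_at A x f -> smooth_at A x g ->
  v (fun z => f z + g z) = v f + v g.
Proof.
move=> tv sf sg; have [c Ac dx] := ga_cover ga x.
rewrite !(tangent_app _ Ac dx tv) -big_split; apply: eq_bigr => j _.
by rewrite coord_vecD// mulrDr.
Qed.

Lemma tangentMr x v f g : tangent A x v -> smooth_at A x f -> smooth_at A x g ->
  v (fun z => f z * g z) = f x * v g + g x * v f.
Proof.
move=> tv sf sg; have [c Ac dx] := ga_cover ga x.
rewrite !(tangent_app _ Ac dx tv) !mulr_sumr -big_split; apply: eq_bigr => j _.
by rewrite coord_vecM//=; ring.
Qed.

Lemma tangent_cst x v (a : R) : tangent A x v -> v (fun=> a) = 0.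
Proof.
move=> tv; have [c Ac dx] := ga_cover ga x.
rewrite (tangent_app _ Ac dx tv) big1// => j _.
by rewrite coord_vec_cst ?mulr0.
Qed.

Lemma tangentNr x v f : tangent A x v -> smooth_at A x f ->
  v (fun z => - f z) = - v f.
Proof.
move=> tv sf; apply/eqP; rewrite -addr_eq0 -(tangentDr tv)//; last exact: smooth_atN.
rewrite (tangent_germ (g := fun=> 0) tv) ?(tangent_cst _ tv)//.
by apply: aroundT => z; rewrite addNr.
Qed.

Lemma tangentBr x v f g : tangent A x v -> smooth_at A x f -> smooth_at A x g ->
  v (fun z => f z - g z) = v f - v g.
Proof.
by move=> tv sf sg; rewrite (tangentDr tv) ?(tangentNr tv)//; exact: smooth_atN.
Qed.

Lemma tangent_sumr x v (I : Type) (r : seq I) (P : pred I) (F : I -> T -> R) :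
  tangent A x v -> (forall i, P i -> smooth_at A x (F i)) ->
  v (fun z => \sum_(i <- r | P i) F i z) = \sum_(i <- r | P i) v (F i).
Proof.
move=> tv sF; elim: r => [|i r IH].
  rewrite big_nil; under eq_fun do rewrite big_nil.
  exact: tangent_cst tv.
rewrite big_cons; under eq_fun do rewrite big_cons.
have [Pi|//] := boolP (P i); rewrite (tangentDr tv) ?IH//; first exact: sF.
exact: smooth_at_sum.
Qed.

(** * Vector fields, brackets and tensors *)

Implicit Types X Y Z : T -> functional R T.

Lemma vf_tangent X x : vector_field A X -> tangent A x (X x).
Proof. by case. Qed.

Lemma vf_coord X c x i : vector_field A X -> A c -> dom c x ->
  smooth_at A x (fun y => X y (coordf c i)).
Proof. by case=> _; apply. Qed.

(** Smoothness of the components in one chart around each point suffices. *)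
Lemma vf_ofP X : (forall x, tangent A x (X x)) ->
  (forall x, exists c, [/\ A c, dom c x &
     forall i, smooth_at A x (fun y => X y (coordf c i))]) ->
  vector_field A X.
Proof.
move=> tX sX; split => // c' x i Ac' dx'.
have [c [Ac dx sc]] := sX x.
apply: (@smooth_at_eq _ (fun y => \sum_(j < m)
  X y (coordf c j) * coord_vec A c j y (coordf c' i))).
  by apply: (around_domS Ac dx) => z dz; rewrite -tangent_app.
apply: smooth_at_sum => j _; apply: smooth_atM; first exact: sc.
by apply: coord_vec_smooth => //; exact: smooth_at_coordf.
Qed.

Lemma vf_smooth X f x : vector_field A X -> smooth_at A x f ->
  smooth_at A x (vf_app X f).
Proof.
move=> vX sf; have [c Ac dx] := ga_cover ga x.
apply: (@smooth_at_eq _ (fun y => \sum_(j < m)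
  X y (coordf c j) * coord_vec A c j y f)).
  apply: (around_domS Ac dx) => z dz; rewrite /vf_app.
  by rewrite [RHS](tangent_app _ Ac dz)//; exact: vf_tangent.
apply: smooth_at_sum => j _; apply: smooth_atM; first exact: vf_coord.
exact: coord_vec_smooth.
Qed.

Lemma bracketE X Y x f : smooth_at A x f ->
  bracket A X Y x f = X x (vf_app Y f) - Y x (vf_app X f).
Proof. by move=> sf; rewrite /bracket; case: asboolP. Qed.

(** The second derivatives of [f] in [X (Y f) - Y (X f)] cancel by symmetry, so
that the bracket is a tangent vector. *)
Lemma bracket_expand X Y c x : vector_field A X -> vector_field A Y ->
  A c -> dom c x ->
  bracket A X Y x =
  \sum_(a < m) bracket A X Y x (coordf c a) *: coord_vec A c a x.
Proof.
move=> vX vY Ac dx; apply/funext => f; rewrite functional_sumE.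
have [sf|sf] := pselect (smooth_at A x f); last first.
  rewrite /bracket; case: asboolP => // _; rewrite big1// => j _.
  by rewrite (coord_vec_nsmooth _ _ sf) mulr0.
have H W W' : vector_field A W -> vector_field A W' ->
    W x (vf_app W' f) = \sum_a (W x (vf_app W' (coordf c a)) * coord_vec A c a x f) +
      \sum_a \sum_b W' x (coordf c a) * W x (coordf c b) *
          coord_vec A c b x (fun z => coord_vec A c a z f).
  move=> vW vW'; rewrite -big_split/=.
  rewrite (@tangent_germ _ _ _ (fun z => \sum_(a < m)
     W' z (coordf c a) * coord_vec A c a z f) (vf_tangent x vW)); last first.
    apply: (around_domS Ac dx) => z dz; rewrite /vf_app.
    by rewrite [LHS](tangent_app _ Ac dz)//; exact: vf_tangent.
  rewrite (tangent_sumr _ (vf_tangent x vW)); last first.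
    move=> a _; apply: smooth_atM; first exact: vf_coord.
    exact: coord_vec_smooth.
  apply: eq_bigr => a _; rewrite (tangentMr (vf_tangent x vW)); last 2 first.
  - exact: vf_coord.
  - exact: coord_vec_smooth.
  rewrite [LHS]addrC [X in X + _ = _]mulrC; congr (_ + _).
  rewrite (tangent_app (fun z => coord_vec A c a z f) Ac dx (vf_tangent x vW)).
  rewrite mulr_sumr.
  by apply: eq_bigr => b _; rewrite mulrA.
rewrite bracketE// !H// opprD addrACA.
rewrite [X in _ + (_ - X)]exchange_big /= -[X in _ + X]sumrB.
rewrite [X in _ + X]big1 ?addr0; last first.
  move=> a _; rewrite -sumrB big1// => b _.
  by rewrite (coord_vecC a b)//; ring.
rewrite -sumrB; apply: eq_bigr => a _.
by rewrite bracketE ?mulrBl//; exact: smooth_at_coordf.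
Qed.

Lemma bracket_tangent X Y x : vector_field A X -> vector_field A Y ->
  tangent A x (bracket A X Y x).
Proof.
move=> vX vY; have [c Ac dx] := ga_cover ga x.
by rewrite (bracket_expand vX vY Ac dx); exact: tangent_sum_coord.
Qed.

Lemma bracket_vf X Y : vector_field A X -> vector_field A Y ->
  vector_field A (bracket A X Y).
Proof.
move=> vX vY; split; first by move=> x; exact: bracket_tangent.
move=> c x i Ac dx; apply: (@smooth_at_eq _ (fun z =>
   X z (vf_app Y (coordf c i)) - Y z (vf_app X (coordf c i)))).
  by apply: (around_domS Ac dx) => z dz; rewrite bracketE//; exact: smooth_at_coordf.
by apply: smooth_atB; apply: vf_smooth => //; apply: vf_smooth => //;
  exact: smooth_at_coordf.
Qed.

Lemma vf_fmul f X : smooth A f -> vector_field A X -> vector_field A (fmul f X).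
Proof.
move=> sf vX; split=> [x|c x i Ac dx]; first exact/tangentZ/vf_tangent.
by apply: smooth_atM; [exact: sf|exact: vf_coord].
Qed.

Lemma vfD X Y : vector_field A X -> vector_field A Y -> vector_field A (X + Y).
Proof.
move=> vX vY; split=> [x|c x i Ac dx]; first by apply: tangentD; exact: vf_tangent.
by apply: smooth_atD; exact: vf_coord.
Qed.

Lemma vfN X : vector_field A X -> vector_field A (- X).
Proof.
move=> vX; split=> [x|c x i Ac dx]; first by apply: tangentN; exact: vf_tangent.
by apply: smooth_atN; exact: vf_coord.
Qed.

Lemma bracketDr X Y Z : vector_field A X -> vector_field A Y -> vector_field A Z ->
  bracket A X (Y + Z) = bracket A X Y + bracket A X Z.
Proof.
move=> vX vY vZ; apply/funext => x; apply/funext => f.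
have [sf|sf] := pselect (smooth_at A x f); last first.
  by rewrite /= -[RHS]/(bracket A X Y x f + bracket A X Z x f) /bracket;
   case: asboolP => // _; rewrite addr0.
rewrite -[RHS]/(bracket A X Y x f + bracket A X Z x f) !bracketE//.
rewrite -[(Y + Z) x _]/(Y x (vf_app X f) + Z x (vf_app X f)).
rewrite (tangentDr (vf_tangent x vX)); try exact: vf_smooth.
by rewrite opprD addrACA.
Qed.

Lemma bracket0r X : vector_field A X -> bracket A X 0 = 0.
Proof.
move=> vX; apply/funext => x; apply/funext => f.
rewrite -[RHS]/(0 : R) /bracket; case: asboolP => // sf.
rewrite -[0 x _]/(0 : R) subr0 -[vf_app 0 f]/(fun=> 0 : R).
exact: (tangent_cst _ (vf_tangent x vX)).
Qed.

Lemma bracket_fmul X Y f : smooth A f -> vector_field A X -> vector_field A Y ->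
  bracket A X (fmul f Y) = fmul (vf_app X f) Y + fmul f (bracket A X Y).
Proof.
move=> sf vX vY; apply/funext => x; apply/funext => g.
rewrite -[RHS]/(X x f * Y x g + f x * bracket A X Y x g).
have [sg|sg] := pselect (smooth_at A x g); last first.
  rewrite /bracket; case: asboolP => // _.
  by rewrite (tangent_nsmooth (vf_tangent x vY) sg) !mulr0 addr0.
rewrite !bracketE// (tangentMr (vf_tangent x vX)); [|exact: sf|exact: vf_smooth].
rewrite -[fmul f Y x _]/(f x * Y x (vf_app X g)).
by rewrite /vf_app; ring.
Qed.

Lemma tensor_sum K x (I : Type) (r : seq I) (P : pred I) (a : I -> R)
    (v : I -> functional R T) : tensor11 A K ->
  (forall i, P i -> tangent A x (v i)) ->
  K x (\sum_(i <- r | P i) a i *: v i) = \sum_(i <- r | P i) a i *: K x (v i).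
Proof.
move=> [_ lK _] tv; elim: r => [|i r IH].
  rewrite !big_nil; have := lK x 1 0 0 (tangent0 x) (tangent0 x).
  rewrite scale1r addr0 => E; apply: (@addrI _ (K x 0)); rewrite addr0.
  by rewrite [in RHS]E scale1r.
rewrite !big_cons; case: ifPn => // Pi.
by rewrite lK ?IH//; [exact: tv|exact: tangent_sum].
Qed.

Lemma vf_tapp K X : tensor11 A K -> vector_field A X -> vector_field A (tapp K X).
Proof.
move=> tK vX; have [tanK linK smK] := tK.
split=> [x|c x j Ac dx]; first exact/tanK/vf_tangent.
apply: (@smooth_at_eq _ (fun y => \sum_(i < m)
  X y (coordf c i) * K y (coord_vec A c i y) (coordf c j))).
  apply: (around_domS Ac dx) => z dz; rewrite /tapp.
  rewrite [in RHS](tangent_expand Ac dz (vf_tangent z vX)) tensor_sum//.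
    by rewrite functional_sumE.
  by move=> i _; exact: tangent_coord_vec.
apply: smooth_at_sum => i _; apply: smooth_atM; first exact: vf_coord.
exact: smK.
Qed.

End AtlasCalculus.

(** * Bump functions *)

Section BumpFunctions.
Variable R : realType.

(** The functions p(1/t) exp(-1/t), extended by 0 to t <= 0.  Letting the
polynomial vary makes the family stable under derivation. *)
Definition flat (p : {poly R}) (t : R) : R :=
  if 0 < t then p.[t^-1] * expR (- t^-1) else 0.

(** The derivative of p(1/t) exp(-1/t) is (p - p')(1/t) / t^2 exp(-1/t). *)
Definition dflat (p : {poly R}) : {poly R} := 'X^2 * (p - p^`()).

Lemma horner_bound (p : {poly R}) :
  exists2 C : R, 0 <= C & forall u, 1 <= u -> `|p.[u]| <= C * u ^+ size p.
Proof.
exists (\sum_(i < size p) `|p`_i|); first exact: sumr_ge0.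
move=> u u1; rewrite horner_coef (le_trans (ler_norm_sum _ _ _))// mulr_suml.
apply: ler_sum => i _; rewrite normrM ler_wpM2l// ger0_norm; last first.
  by rewrite exprn_ge0// (le_trans ler01).
by rewrite ler_weXn2l// ltnW.
Qed.

(** With N the size of [p], p(u) is O(u^N) and exp(u) >= u^(N+1) / (N+1)!, so that
p(u) exp(-u) is O(1/u). *)
Lemma flat_small (p : {poly R}) :
  exists2 C : R, 0 <= C & forall t, 0 < t -> t <= 1 -> `|flat p t| <= C * t.
Proof.
have [C C0 pC] := horner_bound p; set N := size p in pC.
exists (C * N.+1`!%:R); first by rewrite mulr_ge0.
move=> t t0 t1; rewrite /flat t0 normrM (ger0_norm (expR_ge0 _)) expRN.
have u1 : 1 <= t^-1 by rewrite invf_ge1.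
have u0 : 0 < t^-1 by rewrite invr_gt0.
rewrite ler_pdivrMr ?expR_gt0// (le_trans (pC _ u1))// -!mulrA ler_wpM2l//.
have := @expR_ge1Dxn _ t^-1 N (ltW u0).
move=> /(le_trans (ler_wpDl ler01 (lexx _))).
rewrite ler_pdivrMr ?ltr0n ?fact_gt0// exprSr ler_pdivrMr// => /le_trans; apply.
by rewrite le_eqVlt; apply/orP; left; apply/eqP; ring.
Qed.

(** At 0, the difference quotient of [flat p] is [flat ('X * p)], which tends to
0 by [flat_small]. *)
Lemma is_derive_flat (p : {poly R}) (t : R) :
  is_derive t 1 (flat p) (flat (dflat p) t).
Proof.
have [t0|t0|<-] := ltgtP 0 t.
- have E : \forall s \near t, p.[s^-1] * expR (- s^-1) = flat p s.
    by near=> s; rewrite /flat ifT//; near: s; exact: lt_nbhsr.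
  apply: near_eq_is_derive E _.
  have dp : is_derive t^-1 1 (horner p) (p^`()).[t^-1].
    exact: is_derive_poly.
  have dV : is_derive t 1 (fun s : R => s^-1) (- t ^- 2).
    have := is_deriveV (lt0r_neq0 t0) (is_derive_id t 1).
    by move=> dv; apply: is_derive_eq dv _; rewrite /GRing.scale /= mulr1.
  have d1 := is_derive1_comp dp dV.
  have dN : is_derive t 1 (fun s : R => - s^-1) (- - t ^- 2) by exact: is_deriveN.
  have d2 := @is_derive1_comp _ expR (fun s : R => - s^-1) t _ _ (is_derive_expR _) dN.
  apply: is_derive_eq (is_deriveM d1 d2) _.
  rewrite /flat t0 /dflat !hornerE /= /GRing.scale /= -exprVn.
  by ring.
- rewrite /flat ltNge (ltW t0) /=.
  have E : \forall s \near t, 0 = flat p s.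
    by near=> s; rewrite /flat ltNge ltW//=; near: s; exact: lt_nbhsl.
  by apply: near_eq_is_derive E _; exact: is_derive_cst.
- rewrite {2}/flat ltxx; have [C C0 pC] := flat_small ('X * p).
  have lim0 : h^-1 *: (flat p (h *: 1 + 0) - flat p 0) @[h --> 0^'] --> (0 : R).
    apply/cvgrPdist_le => e e0.
    have e1 : 0 < e / (C + 1) by rewrite divr_gt0// ltr_wpDl.
    near=> h.
    rewrite sub0r normrN {2}/flat ltxx subr0 addr0 /GRing.scale/= mulr1.
    have [h0|h0] := ltP 0 h; last by rewrite /flat ltNge h0 /= mulr0 normr0 ltW.
    have -> : h^-1 * flat p h = flat ('X * p) h.
      by rewrite /flat h0 hornerM hornerX mulrA.
    have h1 : h <= 1.
      apply: ltW; apply: (le_lt_trans (ler_norm h)).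
      near: h; apply: dnbhs0_lt => //.
    have he : h <= e / (C + 1).
      apply: ltW; apply: (le_lt_trans (ler_norm h)).
      by near: h; apply: dnbhs0_lt.
    rewrite (le_trans (pC _ h0 h1))// (@le_trans _ _ ((C + 1) * h))//.
      by rewrite ler_wpM2r ?lerDl// ltW.
    by rewrite mulrC -ler_pdivlMr// ltr_wpDl.
  apply: DeriveDef; first by apply/cvg_ex; exists 0.
  by rewrite /derive; exact: cvg_lim lim0.
Unshelve. all: by end_near. Qed.

Lemma flat_smooth (p : {poly R}) (y : 'rV[R]_1) :
  smooth_near y (fun y => flat p (y 0 0)).
Proof.
apply/smooth_nearP; exists setT; first by split; [exact: openT|].
have dcoord z : is_diff z (fun y : 'rV[R]_1 => y 0 0) (fun y => y 0 0).
  have dc : differentiable (fun y : 'rV[R]_1 => y 0 0) z by exact: differentiable_coord.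
  apply: DiffDef => //; apply/funext => v; rewrite -deriveE//.
  have -> : v = v 0 0 *: delta_mx 0 0.
    by apply/matrixP => i j; rewrite !ord1 !mxE !eqxx mulr1.
  rewrite deriveE// linearZ -deriveE//= !mxE eqxx.
  by rewrite -[X in _ *: X]/(partial 0 _ z) partial_coord eqxx.
have dflat_at q (z : 'rV[R]_1) : differentiable (flat q) (z 0 0).
  by apply/derivable1_diffP; have := is_derive_flat q (z 0 0) => -[].
apply: (@smooth_on_stable _ _ _ (fun f => exists q, f = fun y => flat q (y 0 0))).
- exact: openT.
- move=> f [q ->] z _; apply: (@differentiable_comp _ _ _ _ (fun y : 'rV[R]_1 => y 0 0)) => //.
- move=> f i [q ->]; exists (fun y => flat (dflat q) (y 0 0)); first by exists (dflat q).
  move=> z _; rewrite /partial ord1.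
  have dc : differentiable (fun y : 'rV[R]_1 => y 0 0) z by exact: ex_diff.
  rewrite (deriveE _ (differentiable_comp dc (dflat_at q z))) diff_comp//=.
  rewrite diff_val mxE eqxx /= -deriveE//.
  by have := is_derive_flat q (z 0 0) => -[].
- by exists p.
Qed.

(** The product over the coordinates of exp(-1/t), extended by 0 to t <= 0, at
t = r^2 - (y_k - a_k)^2. *)
Lemma cube_bump m (a : 'rV[R]_m) (r : R) : 0 < r ->
  exists B : 'rV[R]_m -> R,
    [/\ forall y, smooth_near y B, B a != 0 &
        forall y, B y != 0 -> forall k, y 0 k \in `[a 0 k - r, a 0 k + r]].
Proof.
move=> r0; pose q k (y : 'rV[R]_m) := r ^+ 2 - (y 0 k - a 0 k) ^+ 2.
exists (fun y => \prod_(k < m) flat 1 (q k y)); split.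
- move=> y; apply: smooth_near_prod => k.
  have sq : smooth_near y (q k).
    have -> : q k = cst (r ^+ 2) \+ (cst (-1) \*
        (((fun y : 'rV[R]_m => y 0 k) \+ cst (- a 0 k)) \*
         ((fun y : 'rV[R]_m => y 0 k) \+ cst (- a 0 k)))).
      by apply/funext => z /=; rewrite /q; ring.
    have sc : smooth_near y ((fun y : 'rV[R]_m => y 0 k) \+ cst (- a 0 k)).
      by apply: smooth_nearD; [exact: smooth_near_coord|exact: smooth_near_cst].
    apply: smooth_nearD; first exact: smooth_near_cst.
    by apply: smooth_nearM; [exact: smooth_near_cst|exact: smooth_nearM].
  have := @smooth_near_comp _ _ _ (fun y : 'rV[R]_1 => flat 1 (y 0 0)) (fun=> q k) y
    (fun=> sq) (flat_smooth 1 _).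
  by under eq_fun do rewrite mxE.
- apply/prodf_neq0 => k _; rewrite /q subrr expr0n subr0 /flat exprn_gt0//.
  by rewrite hornerC mul1r gt_eqF// expR_gt0.
- move=> y /prodf_neq0 By k; have := By k isT; rewrite /flat; case: ifPn; last by rewrite eqxx.
  move=> + _; rewrite /q in_itv/= => yk.
  by apply/andP; split; nra.
Qed.

End BumpFunctions.

(** * The charts of the base manifold *)

Section ManifoldAtlas.
Variables (R : realType) (M : topologicalType) (n : nat) (A : set (chart R M n)).
Hypothesis mA : smooth_manifold A.

Lemma manifold_good_atlas : good_atlas A.
Proof.
split.
- by move=> c Ac; have [_ ? _ _] := mfd_chart mA Ac.
- move=> c c' x Ac Ac' dx dx'.
  have [od _ _ om] := mfd_chart mA Ac; have [od' _ _ _] := mfd_chart mA Ac'.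
  apply/near_openP; exists (coord c @` (dom c `&` dom c')).
    by split; [apply: om; [exact: openI|exact: subIsetl]|exists x].
  by move=> _ [z [dz dz'] <-]; exists z.
- exact: mfd_cover mA.
- exact: mfd_compatible mA.
Qed.

Lemma around_open (O : set M) x : open O -> O x -> around A x O.
Proof.
move=> oO Ox c Ac dx; have [od _ _ om] := mfd_chart mA Ac.
apply/near_openP; exists (coord c @` (dom c `&` O)).
  by split; [apply: om; [exact: openI|exact: subIsetl]|exists x].
move=> _ [z [dz Oz] <-] z' dz' E.
by rewrite (coord_inj manifold_good_atlas Ac dz' dz E).
Qed.

(** The points with coordinates in [K] form a compact set, the image of [K] by
the inverse of the chart; compact sets are closed in a Hausdorff space. *)
Lemma chart_compact_closed c (K : set 'rV[R]_n) (x0 : M) : A c ->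
  compact K -> K `<=` coord c @` dom c ->
  closed (dom c `&` coord c @^-1` K).
Proof.
(* [x0] only serves as the value of the inverse outside of its domain. *)
move=> Ac cK Kc; pose inv y := xget x0 [set x | dom c x /\ coord c x = y].
have invK x : dom c x -> inv (coord c x) = x.
  move=> dx; rewrite /inv; case: xgetP => [z _ [dz]|/(_ x)]; last by case.
  exact: (coord_inj manifold_good_atlas Ac).
have -> : dom c `&` coord c @^-1` K = inv @` K.
  apply/seteqP; split => [x [dx Kx]|_ [y Ky <-]]; first by exists (coord c x) => //; exact: invK.
  by have [x dx E] := Kc _ Ky; rewrite -E invK//; split => //=; rewrite E.
apply: compact_closed; first exact: (mfd_hausdorff mA).
apply: continuous_compact => //; apply: continuous_in_subspaceT => y.
rewrite inE => /Kc[x dx <-] O.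
rewrite invK// => /near_openP[V [oV Vx] VO].
have [od _ _ om] := mfd_chart mA Ac.
apply/(near_openP (coord c x) (fun y => O (inv y))); exists (coord c @` (dom c `&` V)).
  by split; [apply: om; [exact: openI|exact: subIsetl]|exists x].
by move=> _ [z [dz Vz] <-]; rewrite /= invK//; exact: VO.
Qed.

(** The last condition says that [b] vanishes near every point outside of the
chart, and not just at it.  It makes the product of [b] with any object that is
smooth on the chart smooth everywhere. *)
Lemma chart_bump c x0 : A c -> dom c x0 ->
  exists b : M -> R, [/\ b x0 != 0, forall x, dom c x -> smooth_at A x b &
    forall x, ~ dom c x -> around A x (fun z => b z = 0)].
Proof.
move=> Ac dx0; have [od _ _ om] := mfd_chart mA Ac.
have : open (coord c @` dom c) by exact: om.
rewrite openE => /(_ (coord c x0)) /(_ (ex_intro2 _ _ x0 dx0 erefl)).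
rewrite /interior => /nbhs_ballP[r /= r0 rc].
have r2 : 0 < r / 2 by rewrite divr_gt0.
have [B [sB Ba B0]] := cube_bump (coord c x0) r2.
pose K := [set v : 'rV[R]_n | forall k,
   v 0 k \in `[coord c x0 0 k - r / 2, coord c x0 0 k + r / 2]].
have cK : compact K.
  apply: (@rV_compact _ n (fun k =>
    `[coord c x0 0 k - r / 2, coord c x0 0 k + r / 2]%classic)).
  by move=> k; exact: segment_compact.
have Kc : K `<=` coord c @` dom c.
  move=> v Kv; apply: rc; split => // i k; rewrite ord1.
  have := Kv k; rewrite in_itv/= -ball_normE /= => /andP[v1 v2].
  by rewrite distrC ltr_norml; apply/andP; split; lra.
have clK := chart_compact_closed x0 Ac cK Kc.
exists (fun x => if `[< dom c x >] then B (coord c x) else 0); split.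
- by case: asboolP.
- move=> x dx; apply: (smooth_at_fun manifold_good_atlas Ac dx _ (sB (coord c x))).
  by apply: aroundT => z dz; case: asboolP.
- move=> x Ndx; have oK : open (~` (dom c `&` coord c @^-1` K)) by rewrite openC.
  have Kx : (~` (dom c `&` coord c @^-1` K)) x by case.
  apply: aroundS (around_open oK Kx) => z Kz.
  case: asboolP => // dz; apply/eqP; apply: contra_notT Kz => Bz.
  by split => //; exact: B0.
Qed.

End ManifoldAtlas.

(** * The induced charts of the slit cotangent bundle *)

Section SlitAtlas.
Variables (R : realType) (M : topologicalType) (n : nat) (A : set (chart R M n)).
Hypothesis mA : smooth_manifold A.
Let gA := manifold_good_atlas mA.
Let At := slit_atlas A.
Implicit Types (c : chart R M n) (z : slit A).

Definition foot z : M := base (sval z).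

Lemma mom_covector (z : cotangent A) : covector A (base z) (mom z).
Proof. by case: z. Qed.

Lemma mom_sum (z : cotangent A) (a : 'I_n -> R) (v : 'I_n -> functional R M) :
  (forall i, tangent A (base z) (v i)) ->
  mom z (\sum_i a i *: v i) = \sum_i a i * mom z (v i).
Proof.
move=> tv; have [lin _] := mom_covector z.
elim: (index_enum _) => [|i r IH].
  have t0 := tangent0 gA (base z).
  rewrite !big_nil; apply: (@addrI _ (mom z 0)); rewrite addr0.
  by rewrite -[X in X + _]mul1r -lin// scaler0 addr0.
by rewrite !big_cons lin ?IH//; exact: tangent_sum.
Qed.

Lemma slit_eq (z z' : slit A) : foot z = foot z' ->
  mom (sval z) = mom (sval z') -> z = z'.
Proof.
case: z z' => [[x p hp] pz] [[x' p' hp'] pz']; rewrite /foot /= => ex ep.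
subst x' p'; have := Prop_irrelevance hp hp'; move: pz pz' => + + E.
by rewrite E => pz pz'; congr exist; exact: Prop_irrelevance.
Qed.

Lemma slit_coordl c i z :
  coordf (slit_chart A c) (lshift n i) z = coordf c i (foot z).
Proof. by rewrite /coordf /= row_mxEl. Qed.

Lemma slit_coordr c i z :
  coordf (slit_chart A c) (rshift n i) z = mom (sval z) (coord_vec A c i (foot z)).
Proof. by rewrite /coordf /= row_mxEr mxE. Qed.

Lemma slit_inj c z z' : A c -> dom c (foot z) -> dom c (foot z') ->
  coord (slit_chart A c) z = coord (slit_chart A c) z' -> z = z'.
Proof.
move=> Ac dz dz' /eq_row_mx[ex ep].
have E : foot z = foot z' by exact: (coord_inj gA Ac).
apply: slit_eq => //; apply/funext => v.
have [tv|tv] := pselect (tangent A (foot z) v); last first.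
  have [_ ->//] := mom_covector (sval z).
  have [_ ->//] := mom_covector (sval z').
  by rewrite -/(foot z') -E.
rewrite (tangent_expand gA Ac dz tv) mom_sum; last first.
  by move=> i; exact: tangent_coord_vec.
rewrite {2}E mom_sum; last by move=> i; exact: tangent_coord_vec.
apply: eq_bigr => i _; congr (_ * _).
by have := congr1 (fun w : 'rV[R]_n => w 0 i) ep; rewrite !mxE.
Qed.

(** All pairs of a point of the chart and of a nonzero row of components come
from a covector, so that the image of an induced chart is open. *)
Lemma slit_surj c x (b : 'rV[R]_n) : A c -> dom c x -> b != 0 ->
  exists z, foot z = x /\ coord (slit_chart A c) z = row_mx (coord c x) b.
Proof.
move=> Ac dx b0.
pose p (v : functional R M) : R :=
  if `[< tangent A x v >] then \sum_i v (coordf c i) * b 0 i else 0.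
have cp : covector A x p.
  split=> [a v w tv tw|v tv]; last by rewrite /p; case: asboolP.
  rewrite /p; case: asboolP => [_|]; last by case; exact: tangentPZ.
  case: asboolP => // _; case: asboolP => // _.
  rewrite mulr_sumr -big_split; apply: eq_bigr => i _.
  by rewrite -[(_ + _) _]/(a * v (coordf c i) + w (coordf c i)) mulrDl mulrA.
have pe i : p (coord_vec A c i x) = b 0 i.
  rewrite /p; case: asboolP => [_|]; last by case; exact: tangent_coord_vec.
  rewrite (bigD1 i)//= coord_vec_coordf// eqxx mul1r big1 ?addr0// => j /negPf ji.
  by rewrite coord_vec_coordf// eq_sym ji mul0r.
pose q := Cotangent cp.
have q0 : mom q <> 0.
  move=> /= p0; move/eqP: b0; apply; apply/rowP => i.
  by rewrite -pe p0 mxE.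
exists (exist _ q q0); split => //=; congr row_mx.
by apply/rowP => i; rewrite mxE pe.
Qed.

(** The momenta change linearly, with the Jacobian matrix of the change of
charts of the base. *)
Lemma slit_coord_change c c' i z : A c -> A c' ->
  dom c (foot z) -> dom c' (foot z) ->
  coordf (slit_chart A c') (rshift n i) z =
  \sum_j coord_vec A c' i (foot z) (coordf c j) *
         coordf (slit_chart A c) (rshift n j) z.
Proof.
move=> Ac Ac' dz dz'; rewrite slit_coordr [X in mom _ X](coord_vec_change gA i Ac Ac')//.
rewrite mom_sum; last by move=> j; exact: tangent_coord_vec.
by apply: eq_bigr => j _; rewrite slit_coordr.
Qed.

Lemma lsubmx_coords (y : 'rV[R]_(n + n)) : lsubmx y = \row_i y 0 (lshift n i).
Proof. by apply/rowP => i; rewrite !mxE. Qed.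

Lemma slit_coord_lsub c z : lsubmx (coord (slit_chart A c) z) = coord c (foot z).
Proof. by rewrite /= row_mxKl. Qed.

Lemma slit_mom_neq0 c z : A c -> dom c (foot z) ->
  rsubmx (coord (slit_chart A c) z) != 0.
Proof.
move=> Ac dz; apply/eqP; rewrite /= row_mxKr => p0.
apply: (svalP z); apply/funext => v.
have [tv|tv] := pselect (tangent A (foot z) v); last first.
  by have [_ ->] := mom_covector (sval z).
rewrite (tangent_expand gA Ac dz tv) mom_sum; last first.
  by move=> i; exact: tangent_coord_vec.
apply: big1 => i _.
by have := congr1 (fun w : 'rV[R]_n => w 0 i) p0; rewrite !mxE => ->; rewrite mulr0.
Qed.

Lemma near_lsub (y : 'rV[R]_(n + n)) (P : 'rV[R]_n -> Prop) :
  (\forall w \near lsubmx y, P w) -> \forall w \near y, P (lsubmx w).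
Proof.
have lc : lsubmx w @[w --> y] --> (lsubmx y : 'rV[R]_n).
  exact: (differentiable_continuous (differentiable_lsubmx y)).
by move=> yP; exact: (lc P yP).
Qed.

Lemma slit_overlap c c' z : A c -> A c' -> dom c (foot z) -> dom c' (foot z) ->
  \forall y \near coord (slit_chart A c) z, exists z',
    [/\ dom c (foot z'), dom c' (foot z') & coord (slit_chart A c) z' = y].
Proof.
move=> Ac Ac' dz dz'.
have near_l : \forall y \near coord (slit_chart A c) z, exists x',
    [/\ dom c x', dom c' x' & coord c x' = lsubmx y].
  apply: (near_lsub (P := fun w => exists x',
    [/\ dom c x', dom c' x' & coord c x' = w])).
  by rewrite slit_coord_lsub; exact: (ga_overlap gA).
have near_r : \forall y \near coord (slit_chart A c) z, rsubmx y != 0.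
  have rc := differentiable_continuous (differentiable_rsubmx (coord (slit_chart A c) z)).
  exact: cvgr_neq0 rc (slit_mom_neq0 Ac dz).
apply: filterS2 near_l near_r => y [x [dx dx' ex]] y0.
have [z' [fz' cz']] := slit_surj Ac dx y0.
by exists z'; rewrite fz' cz' ex hsubmxK.
Qed.

Lemma smooth_near_lsub (f : 'rV[R]_n -> R) (y : 'rV[R]_(n + n)) :
  smooth_near (lsubmx y) f -> smooth_near y (fun y => f (lsubmx y)).
Proof.
rewrite lsubmx_coords => sf.
rewrite (_ : (fun y => f (lsubmx y)) = fun y => f (\row_i y 0 (lshift n i))).
  by apply: smooth_near_comp sf => i; exact: smooth_near_coord.
by apply/funext => w; rewrite lsubmx_coords.
Qed.

Lemma slit_local_rep c z f : A c -> dom c (foot z) ->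
  local_rep (slit_chart A c) f (coord (slit_chart A c) z) = f z.
Proof.
move=> Ac dz; apply: local_rep_coord => // w w'; rewrite !inE => dw dw'.
exact: slit_inj.
Qed.

Lemma slit_compatible c c' : A c -> A c' ->
  compatible (slit_chart A c) (slit_chart A c').
Proof.
move=> Ac Ac' z a dz dz'; set y := coord _ z.
have yl : lsubmx y = coord c (foot z) by exact: slit_coord_lsub.
case: (split_ordP a) => i ->.
  apply: (smooth_near_eq _ (smooth_near_lsub (f := local_rep c (coordf c' i)) _)).
    apply: filterS (slit_overlap Ac Ac dz dz) => _ [w [dw _ <-]].
    by rewrite slit_coord_lsub slit_local_rep// (local_repE gA)// slit_coordl.
  by rewrite yl; exact: (ga_compat gA Ac Ac').
have st j : smooth_near y (fun w => local_rep c
    (fun x => coord_vec A c' i x (coordf c j)) (lsubmx w) * w 0 (rshift n j)).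
  apply: smooth_nearM; last exact: smooth_near_coord.
  apply: (smooth_near_lsub (f := local_rep c (fun x => coord_vec A c' i x (coordf c j)))).
  rewrite yl; have := coord_vec_smooth gA i Ac' dz'.
  by move=> /(_ (coordf c j) (smooth_at_coordf gA j Ac dz)); exact.
have sum_near : smooth_near y (fun w => \sum_j local_rep c
    (fun x => coord_vec A c' i x (coordf c j)) (lsubmx w) * w 0 (rshift n j)).
  elim: (index_enum _) => [|j r IH].
    by under eq_fun do rewrite big_nil; exact: smooth_near_cst.
  by under eq_fun do rewrite big_cons; exact: (smooth_nearD (st j) IH).
apply: smooth_near_eq sum_near.
apply: filterS (slit_overlap Ac Ac' dz dz') => _ [w [dw dw' <-]].
rewrite slit_local_rep// (slit_coord_change i Ac Ac')//.
by apply: eq_bigr => j _; rewrite slit_coord_lsub (local_repE gA).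
Qed.

Lemma slit_good_atlas : good_atlas At.
Proof.
split.
- move=> _ [c Ac <-] z z'; rewrite !inE => dz dz'; exact: slit_inj.
- by move=> _ _ z [c Ac <-] [c' Ac' <-]; exact: slit_overlap.
- move=> z; have [c Ac dz] := ga_cover gA (foot z).
  by exists (slit_chart A c) => //; exists c.
- by move=> _ _ [c Ac <-] [c' Ac' <-]; exact: slit_compatible.
Qed.
Let gS := slit_good_atlas.

Lemma slit_atlasP c : A c -> At (slit_chart A c).
Proof. by exists c. Qed.

Lemma around_foot z (P : M -> Prop) : around A (foot z) P ->
  around At z (fun w => P (foot w)).
Proof.
have [c Ac dz] := ga_cover gA (foot z) => aP.
apply: (around_chart gS (slit_atlasP Ac) (x := z) dz).
have := aP c Ac dz; rewrite -(slit_coord_lsub c z) => cP.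
apply: filterS (near_lsub cP) => y Py w dw E; apply: Py => //.
by rewrite -E slit_coord_lsub.
Qed.

Lemma smooth_at_foot z (f : M -> R) : smooth_at A (foot z) f ->
  smooth_at At z (fun w => f (foot w)).
Proof.
have [c Ac dz] := ga_cover gA (foot z) => sf.
apply: (smooth_at_fun gS (slit_atlasP Ac) (x := z) dz
  (F := fun y => local_rep c f (lsubmx y))).
  by apply: aroundT => w dw; rewrite slit_coord_lsub (local_repE gA).
by apply: smooth_near_lsub; rewrite slit_coord_lsub; exact: sf.
Qed.

(** Read in an induced chart, a function pulled back from the base does not
involve the momenta. *)
Lemma ddp_foot c i z (f : M -> R) : A c -> dom c (foot z) ->
  smooth_at A (foot z) f -> ddp c i z (fun w => f (foot w)) = 0.
Proof.
move=> Ac dz sf; rewrite /ddp coord_vecE; last exact: smooth_at_foot.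
rewrite -(@near_eq_partial _ _ _
  (fun y => local_rep c f (\row_j y 0 (lshift n j)))); last first.
  apply: (near_local_rep_fun gS (slit_atlasP Ac)) => //; apply: aroundT => w dw.
  by rewrite -lsubmx_coords slit_coord_lsub (local_repE gA).
rewrite partial_comp; last 2 first.
- by move=> j; exact: differentiable_coord.
- by rewrite -lsubmx_coords slit_coord_lsub; exact/smooth_near_diff/sf.
by apply: big1 => j _; rewrite partial_coord eq_rlshift mulr0.
Qed.

Lemma ddx_coordl c i j z : A c -> dom c (foot z) ->
  ddx c i z (coordf (slit_chart A c) (lshift n j)) = (i == j)%:R.
Proof.
by move=> Ac dz; rewrite /ddx (coord_vec_coordf gS)// ?eq_lshift//; exists c.
Qed.

Lemma ddx_coordr c i j z : A c -> dom c (foot z) ->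
  ddx c i z (coordf (slit_chart A c) (rshift n j)) = 0.
Proof.
by move=> Ac dz; rewrite /ddx (coord_vec_coordf gS)// ?eq_lrshift//; exists c.
Qed.

Lemma ddp_coordl c i j z : A c -> dom c (foot z) ->
  ddp c i z (coordf (slit_chart A c) (lshift n j)) = 0.
Proof.
by move=> Ac dz; rewrite /ddp (coord_vec_coordf gS)// ?eq_rlshift//; exists c.
Qed.

Lemma ddp_coordr c i j z : A c -> dom c (foot z) ->
  ddp c i z (coordf (slit_chart A c) (rshift n j)) = (i == j)%:R.
Proof.
by move=> Ac dz; rewrite /ddp (coord_vec_coordf gS)// ?eq_rshift//; exists c.
Qed.

Lemma tangent_ddx c i z : A c -> dom c (foot z) -> tangent At z (ddx c i z).
Proof.
move=> Ac dz.
exact: tangent_coord_vec (slit_atlasP Ac) dz.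
Qed.

Lemma tangent_ddp c i z : A c -> dom c (foot z) -> tangent At z (ddp c i z).
Proof.
move=> Ac dz.
exact: tangent_coord_vec (slit_atlasP Ac) dz.
Qed.

Lemma slit_tangent_expand c z v : A c -> dom c (foot z) -> tangent At z v ->
  v = \sum_i v (coordf (slit_chart A c) (lshift n i)) *: ddx c i z +
      \sum_i v (coordf (slit_chart A c) (rshift n i)) *: ddp c i z.
Proof.
move=> Ac dz tv.
by rewrite [LHS](tangent_expand gS (slit_atlasP Ac) dz tv) big_split_ord.
Qed.

Lemma slit_tangent_eq c z v w : A c -> dom c (foot z) ->
  tangent At z v -> tangent At z w ->
  (forall i, v (coordf (slit_chart A c) (lshift n i)) =
             w (coordf (slit_chart A c) (lshift n i))) ->
  (forall i, v (coordf (slit_chart A c) (rshift n i)) =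
             w (coordf (slit_chart A c) (rshift n i))) -> v = w.
Proof.
move=> Ac dz tv tw El Er; apply: (tangent_eq gS (slit_atlasP Ac) _ tv tw) => // a.
by case: (split_ordP a) => i ->.
Qed.

Lemma smooth_ddx c i z f : A c -> dom c (foot z) -> smooth_at At z f ->
  smooth_at At z (fun w => ddx c i w f).
Proof. by move=> Ac dz sf; apply: (coord_vec_smooth gS) => //; exact: slit_atlasP. Qed.

Lemma smooth_ddp c i z f : A c -> dom c (foot z) -> smooth_at At z f ->
  smooth_at At z (fun w => ddp c i w f).
Proof. by move=> Ac dz sf; apply: (coord_vec_smooth gS) => //; exact: slit_atlasP. Qed.

Lemma vertical_tangent z v : vertical z v -> tangent At z v.
Proof.
move=> [c [b [Ac dz ->]]]; apply: (tangent_sum gS) => i _; exact: tangent_ddp.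
Qed.

(** Being vertical is a condition on the base components in any chart, while the
definition provides one chart only. *)
Lemma verticalP c z v : A c -> dom c (foot z) -> tangent At z v ->
  vertical z v <-> forall i, v (coordf (slit_chart A c) (lshift n i)) = 0.
Proof.
move=> Ac dz tv; split=> [[c' [b [Ac' dz' ->]]] i|v0]; last first.
  exists c, (fun i => v (coordf (slit_chart A c) (rshift n i))); split => //.
  rewrite [LHS](slit_tangent_expand Ac dz tv) [X in X + _ = _]big1.
    by rewrite add0r.
  by move=> i _; rewrite v0 scale0r.
rewrite functional_sumE big1// => j _.
rewrite (_ : coordf _ _ = fun w => coordf c i (foot w)) ?ddp_foot ?mulr0//.
  by apply: smooth_at_coordf.
by apply/funext => w; rewrite slit_coordl.
Qed.

End SlitAtlas.

(** * The Hessian of the Hamiltonian and its inverse *)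

Section SmoothMatrices.
Variables (R : realType) (T : Type) (m : nat) (A : set (chart R T m)).
Hypothesis ga : good_atlas A.

Lemma smooth_at_det x k (F : T -> 'M[R]_k) :
  (forall i j, smooth_at A x (fun z => F z i j)) ->
  smooth_at A x (fun z => \det (F z)).
Proof.
move=> sF; rewrite /determinant; apply: smooth_at_sum => // s _.
apply: smooth_atM => //; first exact: smooth_at_cst.
by apply: smooth_at_prod => // i _; exact: sF.
Qed.

Lemma smooth_at_invmx x k (F : T -> 'M[R]_k) i j :
  (forall i j, smooth_at A x (fun z => F z i j)) ->
  around A x (fun z => F z \in unitmx) ->
  smooth_at A x (fun z => invmx (F z) i j).
Proof.
move=> sF uF; apply: (@smooth_at_eq _ _ _ _ ga _
    (fun z => (\det (F z))^-1 * ((-1) ^+ (j + i) * \det (row' j (col' i (F z)))))).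
  by apply: aroundS uF => z uz; rewrite /invmx uz !mxE.
apply: smooth_atM => //.
  apply: smooth_atV => //; last exact: smooth_at_det.
  by have := around_self ga uF; rewrite unitmxE unitfE.
apply: smooth_atM => //; first exact: smooth_at_cst.
by apply: smooth_at_det => a b; under eq_fun do rewrite !mxE; exact: sF.
Qed.

End SmoothMatrices.

Section Hamilton.
Variables (R : realType) (n : nat) (M : topologicalType)
    (A : set (chart R M n)) (H : cotangent A -> R).
Hypothesis hH : hamilton_space H.
Let mA := ham_manifold hH.
Let At := slit_atlas A.
Let gS := slit_good_atlas mA.
Implicit Types (c : chart R M n) (z : slit A).

Local Notation x_ c i := (coordf (slit_chart A c) (lshift n i)).
Local Notation p_ c i := (coordf (slit_chart A c) (rshift n i)).

Let ddx_l c i j z := @ddx_coordl _ _ _ _ mA c i j z.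
Let ddx_r c i j z := @ddx_coordr _ _ _ _ mA c i j z.
Let ddp_l c i j z := @ddp_coordl _ _ _ _ mA c i j z.
Let ddp_r c i j z := @ddp_coordr _ _ _ _ mA c i j z.

Lemma slit_tangent_app c z v f : A c -> dom c (foot z) -> tangent At z v ->
  v f = \sum_i v (x_ c i) * ddx c i z f + \sum_i v (p_ c i) * ddp c i z f.
Proof.
move=> Ac dz tv.
by rewrite [LHS](tangent_app gS f (slit_atlasP Ac) (x := z) dz tv) big_split_ord.
Qed.

Lemma vertical_app c z v f : A c -> dom c (foot z) -> vertical z v ->
  v f = \sum_i v (p_ c i) * ddp c i z f.
Proof.
move=> Ac dz vv; have tv := vertical_tangent mA vv.
have v0 := (verticalP mA Ac dz tv).1 vv.
rewrite (slit_tangent_app f Ac dz tv) [X in X + _ = _]big1; first exact: add0r.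
by move=> i _; rewrite v0 mul0r.
Qed.

Lemma slit_chart_cover z : exists2 c, A c & dom c (foot z).
Proof. exact: (mfd_cover mA). Qed.

Lemma around_slit_dom c z (P : slit A -> Prop) : A c -> dom c (foot z) ->
  (forall w, dom c (foot w) -> P w) -> around At z P.
Proof.
move=> Ac dz; exact: (around_domS gS (slit_atlasP Ac) (x := z) dz).
Qed.

Lemma smooth_x c i z : A c -> dom c (foot z) -> smooth_at At z (x_ c i).
Proof.
move=> Ac dz; exact: (smooth_at_coordf gS _ (slit_atlasP Ac) (x := z) dz).
Qed.

Lemma smooth_p c i z : A c -> dom c (foot z) -> smooth_at At z (p_ c i).
Proof.
move=> Ac dz; exact: (smooth_at_coordf gS _ (slit_atlasP Ac) (x := z) dz).
Qed.

Lemma smooth_H z : smooth_at At z (on_slit H).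
Proof. exact: (ham_smooth hH). Qed.

Lemma hess_unit c z : A c -> dom c (foot z) -> hess H c z \in unitmx.
Proof.
by move=> Ac dz; rewrite -row_free_unit; apply/eqP; exact: (ham_rank hH Ac dz).
Qed.

Lemma hess_sym c z i j : A c -> dom c (foot z) -> hess H c z i j = hess H c z j i.
Proof.
move=> Ac dz; rewrite !mxE.
have C := coord_vecC gS (c := slit_chart A c) (x := z) (rshift n i) (rshift n j)
  (slit_atlasP Ac) dz (smooth_H (z := z)).
exact: C.
Qed.

Lemma gcov_sym c z i j : A c -> dom c (foot z) -> gcov H c i j z = gcov H c j i z.
Proof.
move=> Ac dz; have S : (hess H c z)^T = hess H c z.
  by apply/matrixP => a b; rewrite mxE hess_sym.
by rewrite /gcov -{1}S -trmx_inv mxE.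
Qed.

Lemma hess_gcov c z i j : A c -> dom c (foot z) ->
  \sum_k hess H c z i k * gcov H c k j z = (i == j)%:R.
Proof.
move=> Ac dz; have := mulmxV (hess_unit Ac dz).
by move=> /matrixP/(_ i j); rewrite !mxE => <-; rewrite /gcov.
Qed.

Lemma smooth_hess c z i j : A c -> dom c (foot z) ->
  smooth_at At z (fun w => hess H c w i j).
Proof.
move=> Ac dz; under eq_fun do rewrite mxE.
by apply: smooth_ddp => //; apply: smooth_ddp => //; exact: smooth_H.
Qed.

Lemma smooth_gcov c z i j : A c -> dom c (foot z) ->
  smooth_at At z (gcov H c i j).
Proof.
move=> Ac dz; apply: (smooth_at_invmx gS).
  by move=> a b; exact: smooth_hess.
by apply: (around_slit_dom Ac dz) => w dw; exact: hess_unit.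
Qed.

(** * The Hamiltonian vector field and the tangent structure *)

#[local] Opaque ddx ddp.

Variable rho : slit A -> functional R (slit A).
Hypothesis hrho : hamiltonian_vf H rho.

Lemma rho_app c z f : A c -> dom c (foot z) ->
  rho z f = \sum_i (ddp c i z (on_slit H) * ddx c i z f
                    - ddx c i z (on_slit H) * ddp c i z f).
Proof. by move=> Ac dz; rewrite (hrho Ac dz) fct_sumE. Qed.

Lemma rho_x c z i : A c -> dom c (foot z) ->
  rho z (x_ c i) = ddp c i z (on_slit H).
Proof.
move=> Ac dz; rewrite (rho_app _ Ac dz) -[RHS](sum_delta_r i (fun j => ddp c j z (on_slit H))).
apply: eq_bigr => j _; rewrite (ddx_l _ _ Ac dz) (ddp_l _ _ Ac dz).
by rewrite [X in _ - X]mulr0 subr0.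
Qed.

Lemma rho_p c z i : A c -> dom c (foot z) ->
  rho z (p_ c i) = - ddx c i z (on_slit H).
Proof.
move=> Ac dz; rewrite (rho_app _ Ac dz).
rewrite -[X in - X](sum_delta_r i (fun j => ddx c j z (on_slit H))) -sumrN.
apply: eq_bigr => j _; rewrite (ddx_r _ _ Ac dz) (ddp_r _ _ Ac dz).
by rewrite [X in X - _]mulr0 sub0r.
Qed.

Lemma rho_vf : vector_field At rho.
Proof.
apply: (vf_ofP gS) => z; have [c Ac dz] := slit_chart_cover z.
  rewrite (hrho Ac dz) sumrB; apply: (tangentB gS); apply: (tangent_sum gS) => i _.
    exact: tangent_ddx.
  exact: tangent_ddp.
exists (slit_chart A c); split => //; first exact: slit_atlasP.
move=> a; case: (split_ordP a) => i ->.
  apply: (smooth_at_eq gS (f := fun w => ddp c i w (on_slit H))).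
    by apply: (around_slit_dom Ac dz) => w dw; rewrite rho_x.
  by apply: smooth_ddp => //; exact: smooth_H.
apply: (smooth_at_eq gS (f := fun w => - ddx c i w (on_slit H))).
  by apply: (around_slit_dom Ac dz) => w dw; rewrite rho_p.
by apply: (smooth_atN gS); apply: smooth_ddx => //; exact: smooth_H.
Qed.

Variable J : slit A -> functional R (slit A) -> functional R (slit A).
Hypothesis hJ : adapted_tangent_structure H J.

Lemma J_x c z v i : A c -> dom c (foot z) -> tangent At z v -> J z v (x_ c i) = 0.
Proof.
move=> Ac dz tv; rewrite (hJ Ac dz tv) fct_sumE; apply: big1 => a _.
by rewrite functional_sumE; apply: big1 => b _; rewrite (ddp_l _ _ Ac dz) mulr0.
Qed.

Lemma J_p c z v j : A c -> dom c (foot z) -> tangent At z v ->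
  J z v (p_ c j) = \sum_i gcov H c i j z * v (x_ c i).
Proof.
move=> Ac dz tv; rewrite (hJ Ac dz tv) fct_sumE; apply: eq_bigr => a _.
rewrite functional_sumE -[RHS](sum_delta_r j (fun b => gcov H c a b z * v (x_ c a))).
by apply: eq_bigr => b _; rewrite (ddp_r _ _ Ac dz).
Qed.

Lemma J_vertical z v : tangent At z v -> vertical z (J z v).
Proof.
move=> tv; have [c Ac dz] := slit_chart_cover z.
exists c, (fun j => \sum_i gcov H c i j z * v (x_ c i)); split => //.
rewrite (hJ Ac dz tv) exchange_big /=; apply: eq_bigr => j _.
by rewrite scaler_suml.
Qed.

Lemma J_tangent z v : tangent At z v -> tangent At z (J z v).
Proof. by move=> /J_vertical/(vertical_tangent mA). Qed.

Lemma J_linear z (a : R) v w : tangent At z v -> tangent At z w ->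
  J z (a *: v + w) = a *: J z v + J z w.
Proof.
move=> tv tw; have [c Ac dz] := slit_chart_cover z.
have tvw := tangentPZ gS a tv tw.
apply: (slit_tangent_eq mA Ac dz); first exact: J_tangent.
- by apply: (tangentPZ gS); exact: J_tangent.
- move=> i; rewrite -[RHS]/(a * J z v (x_ c i) + J z w (x_ c i)).
  by rewrite !(J_x _ Ac dz)// mulr0 addr0.
move=> j; rewrite -[RHS]/(a * J z v (p_ c j) + J z w (p_ c j)).
rewrite !(J_p _ Ac dz)// mulr_sumr -big_split /=; apply: eq_bigr => i _.
by rewrite -[(_ + _) _]/(a * v (x_ c i) + w (x_ c i)); ring.
Qed.

Lemma J_tensor : tensor11 At J.
Proof.
split; [exact: J_tangent|exact: J_linear|].
move=> _ z a b [c Ac <-] dz.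
have tav w : dom c (foot w) -> tangent At w (coord_vec At (slit_chart A c) a w).
  by move=> dw; exact: (tangent_coord_vec _ (slit_atlasP Ac) (x := w) dw).
case: (split_ordP b) => j ->.
  apply: (smooth_at_eq gS _ (smooth_at_cst gS 0)).
  by apply: (around_slit_dom Ac dz) => w dw; rewrite (J_x _ Ac dw)//; exact: tav.
apply: (smooth_at_eq gS (f := fun w =>
    \sum_i gcov H c i j w * (a == lshift n i)%:R)).
  apply: (around_slit_dom Ac dz) => w dw; rewrite (J_p _ Ac dw); last exact: tav.
  apply: eq_bigr => i _; rewrite (coord_vec_coordf gS) //; exact: slit_atlasP.
apply: (smooth_at_sum gS) => i _; apply: (smooth_atM gS); last exact: smooth_at_cst.
exact: smooth_gcov.
Qed.

(** The matrix of [J] on the base components is the invertible matrix g_ij. *)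
Lemma J_eq0 z v : tangent At z v -> J z v = 0 -> vertical z v.
Proof.
move=> tv Jv; have [c Ac dz] := slit_chart_cover z.
apply/(verticalP mA Ac dz tv) => k.
have E j : \sum_i gcov H c i j z * v (x_ c i) = 0.
  by rewrite -(J_p j Ac dz tv) Jv.
rewrite -[LHS](sum_delta k (fun i => v (x_ c i))).
under eq_bigr => i _ do rewrite -(hess_gcov k i Ac dz) mulr_suml.
rewrite exchange_big; apply: big1 => j _ /=.
rewrite -[RHS](mulr0 (hess H c z k j)) -[in RHS](E j) mulr_sumr.
by apply: eq_bigr => i _; rewrite (gcov_sym j i Ac dz) mulrA.
Qed.

Lemma J_vert0 z v : vertical z v -> J z v = 0.
Proof.
move=> vv; have tv := vertical_tangent mA vv; have [c Ac dz] := slit_chart_cover z.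
have v0 := (verticalP mA Ac dz tv).1 vv.
apply: (slit_tangent_eq mA Ac dz); [exact: J_tangent|exact: (tangent0 gS)| |].
  by move=> i; rewrite (J_x _ Ac dz tv).
by move=> j; rewrite (J_p _ Ac dz tv); apply: big1 => i _; rewrite v0 mulr0.
Qed.

Definition vertical_field (V : slit A -> functional R (slit A)) :=
  forall z, vertical z (V z).

(** The base components of the bracket are the contraction of [V] with minus the
Hessian of [H] along the fibres, and [J] contracts with its inverse. *)
Lemma J_bracket_vertical V z : vector_field At V -> vertical_field V ->
  J z (bracket At rho V z) = - V z.
Proof.
move=> vV vertV; have [c Ac dz] := slit_chart_cover z.
have tb := bracket_tangent gS z rho_vf vV.
have V0 w i : dom c (foot w) -> V w (x_ c i) = 0.
  by move=> dw; exact: ((verticalP mA Ac dw (vf_tangent w vV)).1 (vertV w)).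
apply: (slit_tangent_eq mA Ac dz); first exact: J_tangent.
- exact/(tangentN gS)/vf_tangent.
- by move=> i; rewrite (J_x _ Ac dz)// -[RHS]/(- V z (x_ c i)) V0// oppr0.
move=> j; rewrite -[RHS]/(- V z (p_ c j)) (J_p _ Ac dz)//.
(* V kills the base coordinates, and rho maps them to the dH/dp_i. *)
have bx i : bracket At rho V z (x_ c i) =
    - \sum_k V z (p_ c k) * hess H c z k i.
  rewrite bracketE; last exact: smooth_x.
  rewrite (tangent_germ gS (g := fun=> 0) (vf_tangent z rho_vf)); last first.
    by apply: (around_slit_dom Ac dz) => w dw; exact: V0.
  rewrite (tangent_cst gS _ (vf_tangent z rho_vf)) sub0r.
  rewrite (tangent_germ gS (g := fun w => ddp c i w (on_slit H)) (vf_tangent z vV)); last first.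
    by apply: (around_slit_dom Ac dz) => w dw; rewrite -rho_x.
  rewrite (vertical_app _ Ac dz (vertV z)); congr (- _).
  by apply: eq_bigr => k _; rewrite mxE.
under eq_bigr => i _ do rewrite bx mulrN mulr_sumr.
rewrite sumrN exchange_big /= -[in RHS](sum_delta_r j (fun k => V z (p_ c k))).
congr (- _); apply: eq_bigr => k _; rewrite -(hess_gcov k j Ac dz) mulr_sumr.
by apply: eq_bigr => i _; ring.
Qed.

End Hamilton.

(** * The dynamical covariant derivative *)

Section Connection.
Variables (R : realType) (n : nat) (M : topologicalType)
    (A : set (chart R M n)) (H : cotangent A -> R)
    (rho : slit A -> functional R (slit A))
    (J N : slit A -> functional R (slit A) -> functional R (slit A)).
Hypotheses (hH : hamilton_space H) (hrho : hamiltonian_vf H rho)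
  (hJ : adapted_tangent_structure H J) (hN : nonlinear_connection N).
Let mA := ham_manifold hH.
Let At := slit_atlas A.
Let gS := slit_good_atlas mA.
Let vrho := rho_vf hH hrho.
Implicit Types (c : chart R M n) (z : slit A) (X Y Z V : slit A -> functional R (slit A)).

Local Notation h := (hproj N).
Local Notation v := (vproj N).
Local Notation brk := (bracket At rho).
Local Notation nab := (nabla At rho N).

Lemma addfE (u w : functional R (slit A)) f : (u + w) f = u f + w f.
Proof. by []. Qed.
Lemma oppfE (u : functional R (slit A)) f : (- u) f = - u f.
Proof. by []. Qed.
Lemma scalefE (a : R) (u : functional R (slit A)) f : (a *: u) f = a * u f.
Proof. by []. Qed.
Lemma zerofE f : (0 : functional R (slit A)) f = 0.
Proof. by []. Qed.
Let funE := (addfE, oppfE, scalefE, zerofE).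

Lemma scale_of_linear (K : functional R (slit A) -> functional R (slit A)) z :
  (forall a u w, tangent At z u -> tangent At z w -> K (a *: u + w) = a *: K u + K w) ->
  forall a u, tangent At z u -> K (a *: u) = a *: K u.
Proof.
move=> KL a u tu; have t0 := tangent0 gS z.
have K0 : K 0 = 0.
  have := KL 1 _ _ t0 t0; rewrite !scale1r addr0 => E.
  by apply: (@addrI _ (K 0)); rewrite addr0 -E.
by have := KL a _ _ tu t0; rewrite addr0 K0 addr0.
Qed.

Lemma N_tensor : tensor11 At N. Proof. by case: hN. Qed.

Lemma N_tangent z u : tangent At z u -> tangent At z (N z u).
Proof. by case: N_tensor => + _ _; apply. Qed.

Lemma N_linear z (a : R) u w : tangent At z u -> tangent At z w ->
  N z (a *: u + w) = a *: N z u + N z w.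
Proof. by case: N_tensor => _ + _; apply. Qed.

Lemma N_invol z u : tangent At z u -> N z (N z u) = u.
Proof. by case: hN => _ + _; apply. Qed.

Lemma N_vertical z u : vertical z u -> N z u = - u.
Proof.
move=> vu; case: hN => _ _ /(_ z u (vertical_tangent mA vu))[_ /(_ vu) E].
by apply/eqP; rewrite -addr_eq0 addrC E.
Qed.

Lemma vertical0 z : vertical z (0 : functional R (slit A)).
Proof.
have [c Ac dz] := slit_chart_cover hH z; exists c, (fun=> 0).
by split => //; rewrite big1// => i _; rewrite scale0r.
Qed.

Lemma h_tangent z u : tangent At z u -> tangent At z (h z u).
Proof. by move=> tu; apply/(tangentZ gS)/(tangentD gS) => //; exact: N_tangent. Qed.

Lemma v_tangent z u : tangent At z u -> tangent At z (v z u).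
Proof. by move=> tu; apply/(tangentZ gS)/(tangentB gS) => //; exact: N_tangent. Qed.

Lemma h_linear z (a : R) u w : tangent At z u -> tangent At z w ->
  h z (a *: u + w) = a *: h z u + h z w.
Proof.
move=> tu tw; rewrite /hproj N_linear//; apply/funext => f; rewrite !funE; ring.
Qed.

Lemma v_linear z (a : R) u w : tangent At z u -> tangent At z w ->
  v z (a *: u + w) = a *: v z u + v z w.
Proof.
move=> tu tw; rewrite /vproj N_linear//; apply/funext => f; rewrite !funE; ring.
Qed.

Lemma hD z u w : tangent At z u -> tangent At z w -> h z (u + w) = h z u + h z w.
Proof. by move=> tu tw; have := h_linear 1 tu tw; rewrite !scale1r. Qed.

Lemma vD z u w : tangent At z u -> tangent At z w -> v z (u + w) = v z u + v z w.
Proof. by move=> tu tw; have := v_linear 1 tu tw; rewrite !scale1r. Qed.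

Lemma hvK z u : h z u + v z u = u.
Proof. by apply/funext => f; rewrite /hproj /vproj !funE; lra. Qed.

Lemma N_hv z u : N z u = h z u - v z u.
Proof. by apply/funext => f; rewrite /hproj /vproj !funE; lra. Qed.

Lemma h_vert z u : vertical z u -> h z u = 0.
Proof. by move=> vu; rewrite /hproj N_vertical// subrr scaler0. Qed.

Lemma v_vert z u : vertical z u -> v z u = u.
Proof.
by move=> vu; rewrite /vproj N_vertical//; apply/funext => f; rewrite !funE; lra.
Qed.

Lemma v_vertical z u : tangent At z u -> vertical z (v z u).
Proof.
move=> tu; case: hN => _ _ /(_ z _ (v_tangent tu))[+ _]; apply.
have -> : v z u = 2^-1 *: u + - (2^-1) *: N z u.
  by apply/funext => f; rewrite /vproj !funE; ring.
have tNu := N_tangent tu.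
rewrite (N_linear _ tu); last exact: (tangentZ gS).
rewrite (scale_of_linear (@N_linear z) _ tNu).
by rewrite N_invol//; apply/funext => f; rewrite !funE; ring.
Qed.

Lemma h_h z u : tangent At z u -> h z (h z u) = h z u.
Proof.
move=> tu; have E := hvK z (h z u).
have tvu := v_vertical tu.
have := hD (h_tangent tu) (v_tangent tu); rewrite hvK (h_vert tvu) addr0.
by move=> <-.
Qed.

Lemma v_h z u : tangent At z u -> v z (h z u) = 0.
Proof.
move=> tu; have := hvK z (h z u); rewrite h_h// => E.
by apply: (@addrI _ (h z u)); rewrite E addr0.
Qed.

Lemma vf_cstmul (a : R) X : vector_field At X -> vector_field At (fun z => a *: X z).
Proof.
move=> vX; apply: (@vf_fmul _ _ _ _ gS (fun=> a)) => // z.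
exact: smooth_at_cst.
Qed.

Lemma h_vf X : vector_field At X -> vector_field At (tapp h X).
Proof.
move=> vX; apply: (@vf_cstmul 2^-1 (X + tapp N X)).
by apply: (vfD gS) => //; apply: (vf_tapp gS) => //; exact: N_tensor.
Qed.

Lemma v_vf X : vector_field At X -> vector_field At (tapp v X).
Proof.
move=> vX; apply: (@vf_cstmul 2^-1 (X - tapp N X)).
apply: (vfD gS) => //; apply: (vfN gS); apply: (vf_tapp gS) => //.
exact: N_tensor.
Qed.

Lemma J_vf X : vector_field At X -> vector_field At (tapp J X).
Proof. by move=> vX; apply: (vf_tapp gS) => //; exact: (J_tensor hH hJ). Qed.

Lemma brk_vf X : vector_field At X -> vector_field At (brk X).
Proof. by move=> vX; exact: (bracket_vf gS vrho vX). Qed.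

Lemma nab_vf X : vector_field At X -> vector_field At (nab X).
Proof.
move=> vX; apply: (vfD gS).
  exact/h_vf/brk_vf/h_vf.
exact/v_vf/brk_vf/v_vf.
Qed.

Lemma JD z u w : tangent At z u -> tangent At z w -> J z (u + w) = J z u + J z w.
Proof. by move=> tu tw; have := J_linear hH hJ 1 tu tw; rewrite !scale1r. Qed.

Lemma JZ z (a : R) u : tangent At z u -> J z (a *: u) = a *: J z u.
Proof. exact: (scale_of_linear (@J_linear _ _ _ _ _ hH _ hJ z)). Qed.

Lemma J_h z u : tangent At z u -> J z (h z u) = J z u.
Proof.
move=> tu; rewrite -{2}(hvK z u) (JD (h_tangent tu) (v_tangent tu)).
by rewrite (J_vert0 hH hJ (v_vertical tu)) addr0.
Qed.

Lemma brkD X Y : vector_field At X -> vector_field At Y ->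
  brk (X + Y) = brk X + brk Y.
Proof. by move=> vX vY; exact: (bracketDr gS vrho vX vY). Qed.

Lemma hvX X : tapp h X + tapp v X = X.
Proof. by apply/funext => z; exact: hvK. Qed.

Lemma brk_hv X z : vector_field At X ->
  brk X z = brk (tapp h X) z + brk (tapp v X) z.
Proof. by move=> vX; rewrite -{1}(hvX X) brkD//; [exact: h_vf|exact: v_vf]. Qed.

Lemma vX_vertical X : vector_field At X -> vertical_field (tapp v X).
Proof. by move=> vX z; apply: v_vertical; exact: vf_tangent. Qed.

Lemma JX_vertical X : vector_field At X -> vertical_field (tapp J X).
Proof. by move=> vX z; apply: (J_vertical hH hJ); exact: vf_tangent. Qed.

Lemma J_brk_vertical V z : vector_field At V -> vertical_field V ->
  J z (brk V z) = - V z.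
Proof. exact: (J_bracket_vertical hH hrho hJ). Qed.

(** For a vertical field only the vertical half of the definition of nabla
remains. *)
Lemma nab_vertical V : vector_field At V -> vertical_field V ->
  nab V = tapp v (brk V).
Proof.
move=> vV VV; rewrite /nabla.
have -> : tapp h V = 0 by apply/funext => z; exact: h_vert.
have -> : tapp v V = V by apply/funext => z; exact: v_vert.
rewrite (bracket0r gS vrho) (_ : tapp h 0 = 0) ?add0r//.
by apply/funext => z; exact/h_vert/vertical0.
Qed.

Lemma J_nab X z : vector_field At X -> J z (nab X z) = J z (brk (tapp h X) z).
Proof.
move=> vX; rewrite -[nab X z]/(h z (brk (tapp h X) z) + v z (brk (tapp v X) z)).
have t1 := vf_tangent z (brk_vf (h_vf vX)).
have t2 := vf_tangent z (brk_vf (v_vf vX)).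
rewrite JD; [|exact: h_tangent|exact: v_tangent].
by rewrite J_h// (J_vert0 hH hJ (v_vertical t2)) addr0.
Qed.

(** The part v X of the field contributes - v X by [J_bracket_vertical]. *)
Lemma J_brk X z : vector_field At X -> J z (brk X z) = J z (nab X z) - v z (X z).
Proof.
move=> vX; rewrite J_nab// brk_hv//.
rewrite (JD (vf_tangent z (brk_vf (h_vf vX))) (vf_tangent z (brk_vf (v_vf vX)))).
by rewrite (J_brk_vertical _ (v_vf vX) (vX_vertical vX)).
Qed.

Lemma nabla_tensorE X z : vector_field At X ->
  nabla_tensor At rho N J X z = v z (brk (tapp J X) z) - J z (brk (tapp h X) z).
Proof.
move=> vX; rewrite -[LHS]/(nab (tapp J X) z - J z (nab X z)) J_nab//.
by rewrite nab_vertical//; [exact: J_vf|exact: JX_vertical].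
Qed.

(** [J] sends [rho, J X] + X to - J X + J X = 0, so this field is vertical. *)
Lemma h_brk_J X z : vector_field At X -> h z (brk (tapp J X) z) = - h z (X z).
Proof.
move=> vX; have tX := vf_tangent z vX.
have tb := vf_tangent z (brk_vf (J_vf vX)).
have vb : vertical z (brk (tapp J X) z + X z).
  apply: (J_eq0 hH hJ); first exact: (tangentD gS).
  by rewrite JD// (J_brk_vertical _ (J_vf vX) (JX_vertical vX)) addNr.
by apply/eqP; rewrite -addr_eq0 -hD// h_vert.
Qed.

(** Decompose [rho, J X], J [rho, X] and N X with h and v: by [h_brk_J] and
[J_brk], all the terms in h X and v X of the right-hand side cancel. *)
Lemma nabla_tensor_lie X : vector_field At X ->
  nabla_tensor At rho N J X = lie_tensor At rho J X + tapp N X.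
Proof.
move=> vX; apply/funext => z; rewrite nabla_tensorE//.
rewrite -[RHS]/(brk (tapp J X) z - J z (brk X z) + N z (X z)).
rewrite (J_brk _ vX) J_nab// N_hv -{2}(hvK z (brk (tapp J X) z)) h_brk_J//.
by apply/funext => f; rewrite !funE; ring.
Qed.

Lemma nabD X Y : vector_field At X -> vector_field At Y -> nab (X + Y) = nab X + nab Y.
Proof.
move=> vX vY; apply/funext => z.
have E K : (forall z u w, tangent At z u -> tangent At z w -> K z (u + w) = K z u + K z w) ->
    (forall X, vector_field At X -> vector_field At (tapp K X)) ->
    K z (brk (tapp K (X + Y)) z) = K z (brk (tapp K X) z) + K z (brk (tapp K Y) z).
  move=> KD vK.
  have -> : tapp K (X + Y) = tapp K X + tapp K Y.
    by apply/funext => w; apply: KD; exact: vf_tangent.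
  by rewrite (brkD (vK _ vX) (vK _ vY)) KD//; exact/vf_tangent/brk_vf/vK.
rewrite -[LHS]/(h z (brk (tapp h (X + Y)) z) + v z (brk (tapp v (X + Y)) z)).
rewrite E; [|exact: hD|exact: h_vf]; rewrite E; [|exact: vD|exact: v_vf].
exact: addrACA.
Qed.

Lemma smooth_rho f : smooth At f -> smooth At (vf_app rho f).
Proof. by move=> sf z; exact: (vf_smooth gS vrho (sf z)). Qed.

Lemma brk_fmul f X : smooth At f -> vector_field At X ->
  brk (fmul f X) = fmul (vf_app rho f) X + fmul f (brk X).
Proof. by move=> sf vX; exact: (bracket_fmul gS sf vrho vX). Qed.

Lemma hZ z (a : R) u : tangent At z u -> h z (a *: u) = a *: h z u.
Proof. exact: (scale_of_linear (@h_linear z)). Qed.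

Lemma vZ z (a : R) u : tangent At z u -> v z (a *: u) = a *: v z u.
Proof. exact: (scale_of_linear (@v_linear z)). Qed.

Lemma nab_fmul f X : smooth At f -> vector_field At X ->
  nab (fmul f X) = fmul (vf_app rho f) X + fmul f (nab X).
Proof.
move=> sf vX; apply/funext => z.
have E K : (forall z u w, tangent At z u -> tangent At z w -> K z (u + w) = K z u + K z w) ->
    (forall z a u, tangent At z u -> K z (a *: u) = a *: K z u) ->
    (forall z u, tangent At z u -> K z (K z u) = K z u) ->
    (forall X, vector_field At X -> vector_field At (tapp K X)) ->
    K z (brk (tapp K (fmul f X)) z) =
    rho z f *: K z (X z) + f z *: K z (brk (tapp K X) z).
  move=> KD KZ KK vK.
  have -> : tapp K (fmul f X) = fmul f (tapp K X).
    by apply/funext => w; apply: KZ; exact: vf_tangent.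
  rewrite (brk_fmul sf (vK _ vX)).
  have tX := vf_tangent z vX; have tK := vf_tangent z (vK _ vX).
  have tb := vf_tangent z (brk_vf (vK _ vX)).
  rewrite -[X in K z X]/(rho z f *: K z (X z) + f z *: brk (tapp K X) z).
  by rewrite KD ?KZ ?KK//; exact: (tangentZ gS).
rewrite -[LHS]/(h z (brk (tapp h (fmul f X)) z) + v z (brk (tapp v (fmul f X)) z)).
rewrite (E h); [|exact: hD|exact: hZ|exact: h_h|exact: h_vf].
rewrite (E v); [|exact: vD|exact: vZ| |exact: v_vf]; last first.
  by move=> w u tu; apply: v_vert; exact: v_vertical.
rewrite addrACA -scalerDr hvK -scalerDr; reflexivity.
Qed.

Lemma starE f X : smooth At f -> newtonoid At rho J X ->
  star At rho J f X = fmul f X + fmul (vf_app rho f) (tapp J X).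
Proof.
move=> sf [vX nX]; rewrite /star brk_fmul//; congr (_ + _); apply/funext => z.
have tX := vf_tangent z vX; have tb := vf_tangent z (brk_vf vX).
rewrite -[LHS]/(J z (rho z f *: X z + f z *: brk X z)).
have -> : J z (rho z f *: X z + f z *: brk X z) = rho z f *: J z (X z) + f z *: J z (brk X z).
  by rewrite JD ?JZ//; exact: (tangentZ gS).
rewrite (_ : J z (brk X z) = 0) ?scaler0 ?addr0//.
by have := congr1 (fun Y => Y z) nX.
Qed.

(** The star products of a Newtonoid field have the form f X + rho(f) J X, and
nabla is a derivation.  The only terms that do not match are
rho(f) nabla (J X) on the left and rho(f) J (nabla X) on the right. *)
Lemma star_leibniz_defect f X : smooth At f -> newtonoid At rho J X ->
  newtonoid At rho J (nab X) ->
  nab (star At rho J f X) =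
  star At rho J (nabla_fun rho f) X + star At rho J f (nab X)
  + fmul (vf_app rho f) (nabla_tensor At rho N J X).
Proof.
move=> sf nX nnX; have [vX _] := nX; have vJ := J_vf vX.
have srf := smooth_rho sf.
rewrite !starE// nabD; [|exact: (vf_fmul gS)|exact: (vf_fmul gS)].
rewrite !nab_fmul//; apply/funext => z; apply/funext => g.
rewrite -[LHS]/(rho z f * X z g + f z * nab X z g +
  (rho z (vf_app rho f) * J z (X z) g + rho z f * nab (tapp J X) z g)).
rewrite -[RHS]/(rho z f * X z g + rho z (vf_app rho f) * J z (X z) g +
  (f z * nab X z g + rho z f * J z (nab X z) g) +
  rho z f * (nab (tapp J X) z g - J z (nab X z) g)).
ring.
Qed.

(** A field is Newtonoid when v X = J (nabla X), by [J_brk].  Applying nabla to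
this equation and exchanging nabla and J gives it for nabla X, since nabla
commutes with v. *)
Lemma newtonoid_nab X :
  (forall Y, vector_field At Y -> nabla_tensor At rho N J Y = 0) ->
  newtonoid At rho J X -> newtonoid At rho J (nab X).
Proof.
move=> dJ [vX nX]; split; first exact: nab_vf.
have vnX := nab_vf vX.
have vXE : tapp v X = tapp J (nab X).
  apply/funext => z; have := J_brk z vX.
  rewrite (_ : J z (brk X z) = 0); last by have := congr1 (fun Y => Y z) nX.
  by move/esym/eqP; rewrite subr_eq0 => /eqP.
apply/funext => z; rewrite -[LHS]/(J z (brk (nab X) z)) J_brk//.
have -> : v z (nab X z) = nab (tapp v X) z.
  rewrite (nab_vertical (v_vf vX) (vX_vertical vX)).
  rewrite -[nab X z]/(h z (brk (tapp h X) z) + v z (brk (tapp v X) z)).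
  have t1 := vf_tangent z (brk_vf (h_vf vX)).
  have t2 := vf_tangent z (brk_vf (v_vf vX)).
  rewrite vD; [|exact: h_tangent|exact: v_tangent].
  by rewrite v_h// add0r (v_vert (v_vertical t2)).
rewrite vXE; have := congr1 (fun Y => Y z) (dJ _ vnX).
rewrite -[LHS]/(nab (tapp J (nab X)) z - J z (nab (nab X) z)).
by move=> E; rewrite -[LHS]opprB E oppr0.
Qed.

(** The field J [rho, X] is vertical, so that its bracket contributes
- J [rho, X] to J [rho, X + J [rho, X]]. *)
Lemma newtonoid_of X : vector_field At X ->
  newtonoid At rho J (X + tapp J (brk X)).
Proof.
move=> vX; have vb := brk_vf vX; have vJb := J_vf vb; split; first exact: (vfD gS).
apply/funext => z; rewrite -[LHS]/(J z (brk (X + tapp J (brk X)) z)) brkD//.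
rewrite -[X in J z X]/(brk X z + brk (tapp J (brk X)) z) JD; try exact/vf_tangent/brk_vf.
by rewrite (J_brk_vertical _ vJb (JX_vertical vb)) subrr.
Qed.

(** By [nabla_tensorE], nabla J only depends on J X and h X, to which vertical
fields do not contribute. *)
Lemma nabla_tensor_newtonoid X : vector_field At X ->
  nabla_tensor At rho N J (X + tapp J (brk X)) = nabla_tensor At rho N J X.
Proof.
move=> vX; have vb := brk_vf vX; have vJb := J_vf vb.
have J0 : tapp J (X + tapp J (brk X)) = tapp J X.
  apply/funext => z; rewrite -[LHS]/(J z (X z + J z (brk X z))).
  rewrite (JD (vf_tangent z vX) (vf_tangent z vJb)).
  by rewrite (J_vert0 hH hJ (JX_vertical vb z)) addr0.
have h0 : tapp h (X + tapp J (brk X)) = tapp h X.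
  apply/funext => z; rewrite -[LHS]/(h z (X z + J z (brk X z))).
  rewrite (hD (vf_tangent z vX) (vf_tangent z vJb)).
  by rewrite (h_vert (JX_vertical vb z)) addr0.
apply/funext => z; rewrite !nabla_tensorE ?J0 ?h0//.
exact: (vfD gS).
Qed.

End Connection.

(** * Global functions and fields with given values at a point *)

Section Globalization.
Variables (R : realType) (n : nat) (M : topologicalType) (A : set (chart R M n)).
Hypothesis mA : smooth_manifold A.
Let At := slit_atlas A.
Let gA := manifold_good_atlas mA.
Let gS := slit_good_atlas mA.
Implicit Types (c : chart R M n) (z : slit A).

Local Notation x_ c i := (coordf (slit_chart A c) (lshift n i)).
Local Notation p_ c i := (coordf (slit_chart A c) (rshift n i)).

(** The function is b (x^k - x^k(z)) for a bump function b: subtracting the value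
at z removes the derivative of b. *)
Lemma global_function c z k : A c -> dom c (foot z) ->
  exists f (r : R), [/\ smooth At f, r != 0 &
    forall u, tangent At z u -> u f = r * u (x_ c k)].
Proof.
move=> Ac dz; have [b [b0 sb zb]] := chart_bump mA Ac dz.
pose a := coordf c k (foot z).
have sx x : dom c x -> smooth_at A x (fun x => coordf c k x - a).
  move=> dx; apply: (smooth_atB gA); last exact: (smooth_at_cst gA).
  exact: (smooth_at_coordf gA _ Ac).
have sf x : smooth_at A x (fun x => b x * (coordf c k x - a)).
  have [dx|dx] := pselect (dom c x); first by apply: (smooth_atM gA); [exact: sb|exact: sx].
  apply: (smooth_at_eq gA _ (smooth_at_cst gA 0)).
  by apply: aroundS (zb x dx) => y ->; rewrite mul0r.
exists (fun w => b (foot w) * (coordf c k (foot w) - a)), (b (foot z)); split => //.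
  by move=> w; exact: (smooth_at_foot mA (sf (foot w))).
move=> u tu; have s1 := smooth_at_foot mA (sb _ dz).
have s2 := smooth_at_foot mA (sx _ dz).
rewrite (tangentMr gS tu s1 s2) {2}/a subrr mul0r addr0; congr (_ * _).
have sk : smooth_at At z (x_ c k).
  exact: (smooth_at_coordf gS _ (slit_atlasP Ac) (x := z) dz).
have -> : (fun w => coordf c k (foot w) - a) = (fun w => x_ c k w - a).
  by apply/funext => w; rewrite slit_coordl.
rewrite (tangentBr gS tu sk (smooth_at_cst gS a)) (tangent_cst gS _ tu).
exact: subr0.
Qed.

Lemma global_field c z k : A c -> dom c (foot z) ->
  exists X (r : R), [/\ vector_field At X, r != 0 & X z = r *: ddx c k z].
Proof.
move=> Ac dz; have [b [b0 sb zb]] := chart_bump mA Ac dz.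
pose X w : functional R (slit A) :=
  if `[< dom c (foot w) >] then b (foot w) *: ddx c k w else 0.
exists X, (b (foot z)); split => //; last by rewrite /X; case: asboolP.
apply: (vf_ofP gS) => w.
  rewrite /X; case: asboolP => dw; last exact: (tangent0 gS).
  by apply/(tangentZ gS)/tangent_ddx.
have [dw|dw] := pselect (dom c (foot w)).
  exists (slit_chart A c); split => // [|a]; first exact: slit_atlasP.
  apply: (smooth_at_eq gS (f := fun y => b (foot y) * (lshift n k == a)%:R)).
    apply: (around_domS gS (slit_atlasP Ac) (x := w) dw) => y dy.
    rewrite /X; case: asboolP => // _; congr (_ * _); rewrite /ddx.
    by rewrite (coord_vec_coordf gS _ _ (slit_atlasP Ac) (x := y) dy).
  apply: (smooth_atM gS); last exact: (smooth_at_cst gS).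
  exact: (smooth_at_foot mA (sb _ dw)).
have [c' Ac' dw'] := ga_cover gA (foot w).
exists (slit_chart A c'); split => // [|a]; first exact: slit_atlasP.
apply: (smooth_at_eq gS _ (smooth_at_cst gS 0)).
apply: aroundS (around_foot mA (zb _ dw)) => y by0.
by rewrite /X; case: asboolP => // _; rewrite by0 scale0r.
Qed.

End Globalization.

(** * The equations in coordinates *)

(** The sums of the coordinate computation of L_rho J + N, for arbitrary
coefficients: g and h are inverse matrices, X and P the components of the field,
N2 twice the coefficients of the connection, rX and rg derivatives along rho,
B and D second derivatives of the Hamiltonian.  The terms in rX cancel, and so do
those in P. *)
Lemma lie_coefficients_algebra (R : comNzRingType) (n : nat) (j : 'I_n)
    (X P rX rg N2 D : 'I_n -> R) (g h B : 'I_n -> 'I_n -> R) :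
  (forall k, \sum_i h k i * g i j = (k == j)%:R) ->
  \sum_i (g i j * rX i + X i * rg i) + \sum_k (\sum_i g i k * X i) * D k
  - \sum_i g i j * (rX i - (\sum_k X k * B k i + \sum_k P k * h k i))
  + (\sum_i X i * N2 i - P j) =
  \sum_i X i * (N2 i + (rg i + (\sum_k g i k * D k + \sum_k g k j * B i k))).
Proof.
move=> hg.
have S3 : \sum_k (\sum_i g i k * X i) * D k = \sum_i X i * \sum_k g i k * D k.
  under eq_bigr => k _ do rewrite mulr_suml.
  rewrite exchange_big; apply: eq_bigr => i _ /=; rewrite mulr_sumr.
  by apply: eq_bigr => k _; ring.
have S4 : \sum_i g i j * (\sum_k X k * B k i) = \sum_i X i * \sum_k g k j * B i k.
  under eq_bigr => k _ do rewrite mulr_sumr.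
  rewrite exchange_big; apply: eq_bigr => i _ /=; rewrite mulr_sumr.
  by apply: eq_bigr => k _; ring.
have S5 : \sum_i g i j * (\sum_k P k * h k i) = P j.
  under eq_bigr => i _ do rewrite mulr_sumr.
  rewrite exchange_big -[RHS](sum_delta_r j P); apply: eq_bigr => k _ /=.
  by rewrite -hg mulr_sumr; apply: eq_bigr => i _; ring.
rewrite S3 -[X in _ + (_ - X)]S5.
under [RHS]eq_bigr => i _ do rewrite !mulrDr.
rewrite !big_split /= -S4.
rewrite (_ : \sum_i g i j * (rX i - _) = \sum_i g i j * rX i -
   (\sum_i g i j * (\sum_k X k * B k i) + \sum_i g i j * (\sum_k P k * h k i))).
  ring.
rewrite -big_split -sumrB /=; apply: eq_bigr => i _; ring.
Qed.

Section Coordinates.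
Variables (R : realType) (n : nat) (M : topologicalType)
    (A : set (chart R M n)) (H : cotangent A -> R)
    (rho : slit A -> functional R (slit A))
    (J N : slit A -> functional R (slit A) -> functional R (slit A))
    (Nc : chart R M n -> slit A -> 'M[R]_n).
Hypotheses (hH : hamilton_space H) (hrho : hamiltonian_vf H rho)
  (hJ : adapted_tangent_structure H J) (hN : nonlinear_connection N)
  (hNc : connection_coefficients N Nc).
Let mA := ham_manifold hH.
Let At := slit_atlas A.
Let gS := slit_good_atlas mA.
Let vrho := rho_vf hH hrho.
Implicit Types (c : chart R M n) (z : slit A) (X Y Z V : slit A -> functional R (slit A)).

Local Notation brk := (bracket At rho).
Local Notation x_ c i := (coordf (slit_chart A c) (lshift n i)).
Local Notation p_ c i := (coordf (slit_chart A c) (rshift n i)).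
Local Notation dH c i := (fun w => ddp c i w (on_slit H)).

(** The mixed derivatives of [H] appear in one order in the formula for the
coefficients, and in the other one in the bracket with [rho]. *)
Lemma ddp_ddx c z i k : A c -> dom c (foot z) ->
  ddp c k z (vf_app (ddx c i) (on_slit H)) = ddx c i z (dH c k).
Proof.
move=> Ac dz.
have C := coord_vecC gS (c := slit_chart A c) (x := z) (rshift n k) (lshift n i)
  (slit_atlasP Ac) dz (smooth_H hH (z := z)).
exact: C.
Qed.

#[local] Opaque ddx ddp gcov hess.

Lemma vertical_ddp c z i : A c -> dom c (foot z) -> vertical z (ddp c i z).
Proof.
move=> Ac dz; exists c, (fun k => (i == k)%:R); split => //.
rewrite (bigD1 i)//= eqxx scale1r big1 ?addr0// => k /negPf ki.
by rewrite eq_sym ki scale0r.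
Qed.

Lemma N_ddx_p c z i j : A c -> dom c (foot z) ->
  N z (ddx c i z) (p_ c j) = 2 * Nc c z i j.
Proof.
move=> Ac dz; have := congr1 (fun u => u (p_ c j)) (hNc i Ac dz).
rewrite -[LHS]/(2^-1 * (ddx c i z (p_ c j) + N z (ddx c i z) (p_ c j))).
rewrite -[RHS]/(ddx c i z (p_ c j) + (\sum_k Nc c z i k *: ddp c k z) (p_ c j)).
rewrite functional_sumE (ddx_coordr mA i j Ac dz) !add0r => E.
have {}E : 2^-1 * N z (ddx c i z) (p_ c j) = Nc c z i j.
  rewrite E -[RHS](sum_delta_r j (fun k => Nc c z i k)).
  by apply: eq_bigr => k _; rewrite (ddp_coordr mA k j Ac dz).
by rewrite -E; field.
Qed.

Lemma N_p c z u j : A c -> dom c (foot z) -> tangent At z u ->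
  N z u (p_ c j) = \sum_i u (x_ c i) * (2 * Nc c z i j) - u (p_ c j).
Proof.
move=> Ac dz tu; have tx i := tangent_ddx i Ac dz; have tp i := tangent_ddp i Ac dz.
have t1 := @tangent_sum _ _ _ _ gS z 'I_n (index_enum _) xpredT
  (fun i => u (x_ c i)) (fun i => ddx c i z) (fun i _ => tx i).
have t2 := @tangent_sum _ _ _ _ gS z 'I_n (index_enum _) xpredT
  (fun i => u (p_ c i)) (fun i => ddp c i z) (fun i _ => tp i).
have E1 := @tensor_sum _ _ _ _ gS N z 'I_n (index_enum _) xpredT
  (fun i => u (x_ c i)) (fun i => ddx c i z) (N_tensor hN) (fun i _ => tx i).
have E2 := @tensor_sum _ _ _ _ gS N z 'I_n (index_enum _) xpredT
  (fun i => u (p_ c i)) (fun i => ddp c i z) (N_tensor hN) (fun i _ => tp i).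
have Nu := N_linear hN 1 t1 t2; rewrite !scale1r in Nu.
have {Nu E1 E2}Nu := etrans Nu (f_equal2 +%R E1 E2).
have E1 : (\sum_i u (x_ c i) *: N z (ddx c i z)) (p_ c j) =
    \sum_i u (x_ c i) * (2 * Nc c z i j).
  by rewrite functional_sumE; apply: eq_bigr => i _; rewrite N_ddx_p.
have E2 : (\sum_i u (p_ c i) *: N z (ddp c i z)) (p_ c j) = - u (p_ c j).
  rewrite functional_sumE -[in RHS](sum_delta_r j (fun i => u (p_ c i))) -sumrN.
  apply: eq_bigr => i _; rewrite (N_vertical hH hN (vertical_ddp i Ac dz)).
  by rewrite -(ddp_coordr mA i j Ac dz) -mulrN.
rewrite {1}(slit_tangent_expand mA Ac dz tu) Nu.
exact: (f_equal2 +%R E1 E2).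
Qed.

Lemma brk_J_p c z X j : A c -> dom c (foot z) -> vector_field At X ->
  brk (tapp J X) z (p_ c j) =
  \sum_i (gcov H c i j z * rho z (fun w => X w (x_ c i)) +
          X z (x_ c i) * rho z (gcov H c i j)) +
  \sum_k (\sum_i gcov H c i k z * X z (x_ c i)) *
         ddp c k z (vf_app (ddx c j) (on_slit H)).
Proof.
move=> Ac dz vX; have sg i := smooth_gcov hH i j Ac dz.
have sX i : smooth_at At z (fun w => X w (x_ c i)).
  exact: (vf_coord _ vX (slit_atlasP Ac) (x := z) dz).
have tr := vf_tangent z vrho; have tX := vf_tangent z vX.
rewrite bracketE; last exact: (smooth_p hH).
congr (_ + _).
  rewrite (tangent_germ gS (g := fun w => \sum_i gcov H c i j w * X w (x_ c i)) tr).
    rewrite (tangent_sumr gS _ tr); last by move=> i _; exact: (smooth_atM gS).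
    by apply: eq_bigr => i _; rewrite (tangentMr gS tr).
  apply: (around_slit_dom hH Ac dz) => w dw.
  exact: (J_p hH hJ _ Ac dw (vf_tangent w vX)).
have sx : smooth_at At z (vf_app (ddx c j) (on_slit H)).
  exact: (smooth_ddx mA _ Ac dz (smooth_H hH (z := z))).
rewrite -[tapp J X z _]/(J z (X z) (vf_app rho (p_ c j))).
have tJ := J_tangent hH hJ tX.
rewrite (tangent_germ gS (g := fun w => - vf_app (ddx c j) (on_slit H) w) tJ).
  rewrite (tangentNr gS tJ sx) opprK (vertical_app hH _ Ac dz (J_vertical hH hJ tX)).
  by apply: eq_bigr => k _; rewrite (J_p hH hJ _ Ac dz tX).
by apply: (around_slit_dom hH Ac dz) => w dw; exact: (rho_p hH hrho).
Qed.

Lemma J_brk_p c z X j : A c -> dom c (foot z) -> vector_field At X ->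
  J z (brk X z) (p_ c j) =
  \sum_i gcov H c i j z * (rho z (fun w => X w (x_ c i)) -
    (\sum_k X z (x_ c k) * ddx c k z (dH c i) +
     \sum_k X z (p_ c k) * hess H c z k i)).
Proof.
move=> Ac dz vX; have tX := vf_tangent z vX.
rewrite (J_p hH hJ _ Ac dz (bracket_tangent gS z vrho vX)).
apply: eq_bigr => i _; congr (_ * _); rewrite bracketE; last exact: (smooth_x hH).
congr (_ - _); rewrite (tangent_germ gS (g := dH c i) tX).
  rewrite (slit_tangent_app hH _ Ac dz tX); congr (_ + _).
  by apply: eq_bigr => k _; rewrite mxE.
by apply: (around_slit_dom hH Ac dz) => w dw; exact: (rho_x hH hrho).
Qed.

Definition canonical_coeff c z i j : R :=
  2^-1 * (poisson c (gcov H c i j) (on_slit H) z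
          - \sum_(k < n)
              (gcov H c i k z * ddp c k z (vf_app (ddx c j) (on_slit H))
               + gcov H c j k z
                 * ddp c k z (vf_app (ddx c i) (on_slit H)))).

Let half_diff (r S1 S2 S3 : R) : S2 = S3 ->
  - (2 * (2^-1 * (- r - (S1 + S2)))) = r + (S1 + S3).
Proof. by move=> ->; field. Qed.

(** The Poisson bracket is minus the derivative along [rho], and the second
derivatives are put in the order in which brackets produce them. *)
Lemma canonical_coeffE c z i j : A c -> dom c (foot z) ->
  - (2 * canonical_coeff c z i j) = rho z (gcov H c i j) +
    (\sum_k gcov H c i k z * ddp c k z (vf_app (ddx c j) (on_slit H)) +
     \sum_k gcov H c k j z * ddx c i z (dH c k)).
Proof.
move=> Ac dz; rewrite /canonical_coeff.
have -> : poisson c (gcov H c i j) (on_slit H) z = - rho z (gcov H c i j).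
  rewrite (rho_app hrho _ Ac dz) -sumrN; apply: eq_bigr => k _.
  by ring.
rewrite big_split /=; apply: half_diff.
apply: eq_bigr => k _.
by rewrite (ddp_ddx i k Ac dz) (gcov_sym hH j k Ac dz).
Qed.

Lemma lie_tensor_p c z X j : A c -> dom c (foot z) -> vector_field At X ->
  (lie_tensor At rho J X + tapp N X) z (p_ c j) =
  \sum_i X z (x_ c i) * (2 * (Nc c z i j - canonical_coeff c z i j)).
Proof.
move=> Ac dz vX; have tX := vf_tangent z vX.
rewrite -[LHS]/(brk (tapp J X) z (p_ c j) - J z (brk X z) (p_ c j) +
  N z (X z) (p_ c j)) brk_J_p// J_brk_p// N_p//.
have hg k := hess_gcov hH k j Ac dz.
apply: (etrans (@lie_coefficients_algebra R n j (fun i => X z (x_ c i))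
  (fun k => X z (p_ c k)) (fun i => rho z (fun w => X w (x_ c i)))
  (fun i => rho z (gcov H c i j)) (fun i => 2 * Nc c z i j)
  (fun k => ddp c k z (vf_app (ddx c j) (on_slit H)))
  (fun i k => gcov H c i k z) (fun k i => hess H c z k i)
  (fun k i => ddx c k z (dH c i)) hg)).
apply: eq_bigr => i _; congr (_ * _).
by rewrite mulrBr (canonical_coeffE i j Ac dz).
Qed.

(** As nabla J, the tensor is a difference of vertical vectors. *)
Lemma lie_tensor_x c z X i : A c -> dom c (foot z) -> vector_field At X ->
  (lie_tensor At rho J X + tapp N X) z (x_ c i) = 0.
Proof.
move=> Ac dz vX; rewrite -(nabla_tensor_lie hH hrho hJ hN vX).
rewrite (nabla_tensorE hH hrho hJ hN z vX).
have vb := brk_vf hH hrho (J_vf hH hJ vX).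
have vh := brk_vf hH hrho (h_vf hH hN vX).
have v1 := v_vertical hH hN (vf_tangent z vb).
rewrite -[LHS]/(vproj N z (brk (tapp J X) z) (x_ c i) -
  J z (brk (tapp (hproj N) X) z) (x_ c i)).
rewrite (J_x hH hJ _ Ac dz (vf_tangent z vh)) subr0.
exact: ((verticalP mA Ac dz (vertical_tangent mA v1)).1 v1).
Qed.

Lemma lie_tensor_vf X : vector_field At X ->
  vector_field At (lie_tensor At rho J X + tapp N X).
Proof.
move=> vX; have vJ := J_vf hH hJ vX; have vb := brk_vf hH hrho vX.
apply: (vfD gS); last by apply: (vf_tapp gS) => //; exact: (N_tensor hN).
apply: (vfD gS); first exact: (brk_vf hH hrho vJ).
exact/(vfN gS)/(J_vf hH hJ vb).
Qed.

Lemma lie_tensor_eq0P :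
  (forall X, vector_field At X -> lie_tensor At rho J X + tapp N X = 0) <->
  (forall c z, A c -> dom c (foot z) -> forall i j,
     Nc c z i j = canonical_coeff c z i j).
Proof.
split=> [E c z Ac dz i j|E X vX].
  have [X [r [vX r0 Xz]]] := global_field mA i Ac dz.
  have := lie_tensor_p j Ac dz vX; rewrite (E _ vX) -[LHS]/(0 : R) Xz.
  rewrite (_ : \sum_k _ = r * (2 * (Nc c z i j - canonical_coeff c z i j))).
    move/esym/eqP; rewrite !mulf_eq0 (negPf r0) pnatr_eq0 /= subr_eq0.
    by move/eqP.
  rewrite -[RHS](sum_delta i (fun k => r * (2 * (Nc c z k j - canonical_coeff c z k j)))).
  apply: eq_bigr => k _; rewrite scalefE (ddx_coordl mA i k Ac dz); ring.
apply/funext => z; have [c Ac dz] := slit_chart_cover hH z.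
apply: (slit_tangent_eq mA Ac dz).
- exact/vf_tangent/lie_tensor_vf.
- exact: (tangent0 gS).
- by move=> i; exact: lie_tensor_x.
move=> j; rewrite lie_tensor_p//; apply: big1 => i _.
by rewrite E// subrr !mulr0.
Qed.

(** Suppose that [Z] does not vanish at [z].  By continuity it does not vanish
near [z], so [rho f] vanishes there for all [f], and so do the base components
dH/dp_k of [rho], which some [f] detects by [global_function].  Then the Hessian
of [H] along the fibre is zero at [z], although it is invertible. *)
Lemma rho_multiples_eq0 Z : vector_field At Z ->
  (forall f, smooth At f -> fmul (vf_app rho f) Z = 0) -> Z = 0.
Proof.
move=> vZ Zf; apply/funext => z; have [c Ac dz] := slit_chart_cover hH z.
apply: (tangent_eq gS (slit_atlasP Ac) (x := z) dz (vf_tangent z vZ) (tangent0 gS z)).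
move=> a; apply/eqP/negP => /negP Za.
have sZ := vf_coord a vZ (slit_atlasP Ac) (x := z) dz.
have dH0 k : around At z (fun w => ddp c k w (on_slit H) = 0).
  apply: aroundS (aroundI (around_neq0 gS sZ Za)
    (around_dom gS (slit_atlasP Ac) (x := z) dz)) => w [Zw dw].
  have [f [r [sf r0 fE]]] := global_function mA k Ac dw.
  have := congr1 (fun Y => Y w (coordf (slit_chart A c) a)) (Zf f sf).
  rewrite -[LHS]/(rho w f * Z w (coordf (slit_chart A c) a)) -[RHS]/(0 : R).
  rewrite (fE _ (vf_tangent w vrho)) (rho_x hH hrho k Ac dw) => /eqP.
  by rewrite !mulf_eq0 (negPf r0) (negPf Zw) orbF => /eqP.
have h0 i k : hess H c z i k = 0.
  rewrite mxE (tangent_germ gS (g := fun=> 0) (tangent_ddp i Ac dz) (dH0 k)).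
  exact: (tangent_cst gS _ (tangent_ddp i Ac dz)).
(* The index [a] excludes the dimension 0, where the zero matrix is invertible. *)
have i : 'I_n by case: (split_ordP a).
have := hess_gcov hH i i Ac dz; rewrite eqxx big1 => [/eqP|k _]; last by rewrite h0 mul0r.
by rewrite eq_sym oner_eq0.
Qed.

End Coordinates.

Theorem theorem2 (R : realType) (n : nat) (M : topologicalType)
    (A : set (chart R M n)) (H : cotangent A -> R)
    (rho : slit A -> functional R (slit A))
    (J N : slit A -> functional R (slit A) -> functional R (slit A))
    (Nc : chart R M n -> slit A -> 'M[R]_n)
    (hH : hamilton_space H)
    (hrho : hamiltonian_vf H rho)
    (hJ : adapted_tangent_structure H J)
    (hN : nonlinear_connection N)
    (hNc : connection_coefficients N Nc) :
  let At := slit_atlas A in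
  [<->
    (* (i) *)
    (forall X, newtonoid At rho J X -> newtonoid At rho J (nabla At rho N X)) /\
    (forall f X, smooth At f -> newtonoid At rho J X ->
       nabla At rho N (star At rho J f X) =
       star At rho J (nabla_fun rho f) X + star At rho J f (nabla At rho N X));
    (* (ii) *)
    forall X, vector_field At X -> nabla_tensor At rho N J X = 0;
    (* (iii) *)
    forall X, vector_field At X -> lie_tensor At rho J X + tapp N X = 0;
    (* (iv) *)
    forall c (z : slit A), A c -> dom c (base (sval z)) ->
      forall i j, Nc c z i j =
        2^-1 * (poisson c (gcov H c i j) (on_slit H) z
                - \sum_(k < n)
                    (gcov H c i k z * ddp c k z (vf_app (ddx c j) (on_slit H))
                     + gcov H c j k z
                       * ddp c k z (vf_app (ddx c i) (on_slit H))))].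
Proof.
move=> At; have [to_iv of_iv] := lie_tensor_eq0P hH hrho hJ hN hNc.
tfae.
- move=> [stab leib] X vX.
  have nX := newtonoid_of hH hrho hJ vX.
  rewrite -(nabla_tensor_newtonoid hH hrho hJ hN vX).
  apply: (rho_multiples_eq0 hH hrho).
    rewrite (nabla_tensor_lie hH hrho hJ hN (proj1 nX)).
    exact: (lie_tensor_vf hH hrho hJ hN (proj1 nX)).
  move=> f sf; have := star_leibniz_defect hH hrho hJ hN sf nX (stab _ nX).
  rewrite leib// => /esym/eqP; rewrite addrC -subr_eq0 addrK => /eqP.
  exact.
- move=> E X vX; rewrite -(nabla_tensor_lie hH hrho hJ hN vX); exact: E.
- exact: to_iv.
- move=> /of_iv E.
  have E2 X : vector_field At X -> nabla_tensor At rho N J X = 0.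
    by move=> vX; rewrite (nabla_tensor_lie hH hrho hJ hN vX); exact: E.
  have stab X : newtonoid At rho J X -> newtonoid At rho J (nabla At rho N X).
    exact: (newtonoid_nab hH hrho hJ hN E2).
  split=> // f X sf nX.
  rewrite (star_leibniz_defect hH hrho hJ hN sf nX (stab _ nX)).
  rewrite (E2 _ (proj1 nX)) (_ : fmul _ 0 = 0) ?addr0//.
  by apply/funext => z; exact: scaler0.
Qed.
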